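(* Let $\mathcal L$ be a semilattice, $(\mathfrak A,(A_i)_{i\in\mathcal L})$ an $\mathcal L$-graded $C^*$-algebra and $B$ a $C^*$-algebra. Suppose given, for every $i\in\mathcal L$, a homomorphism $\psi_i:A_i\to B$, such that for all $j,k\in\mathcal L$ and all $x\in A_j$, $y\in A_k$ we have $\psi_{j\wedge k}(xy)=\psi_j(x)\psi_k(y)$. Then there exists a unique homomorphism $\psi:\mathfrak A\to B$ whose restriction to $A_i$ is $\psi_i$ for every $i\in\mathcal L$.
   Context: A semilattice is a partially ordered set $\mathcal L$ in which any two elements $k,\ell$ have a greatest lower bound $k\wedge\ell$. A $C^*$-algebra $\mathfrak A$ is $\mathcal L$-graded with components $(A_i)_{i\in\mathcal L}$, written $(\mathfrak A,(A_i)_{i\in\mathcal L})$, if $(A_i)_{i\in\mathcal L}$ is a family of sub-$C^*$-algebras of $\mathfrak A$ which is linearly independent (if $S_i\in A_i$, only finitely many $S_i$ are nonzero and $\sum_i S_i=0$, then all $S_i=0$), total (the linear span of $\bigcup_i A_i$ is dense in $\mathfrak A$), and satisfies $A_iA_j\subset A_{i\wedge j}$ for all $i,j\in\mathcal L$. Homomorphisms of $C^*$-algebras are $*$-homomorphisms. *)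

(* Defs.v *)
(* MathComp-Analysis, with the complex numbers R[i] over R : realType *)
From HB Require Import structures.
From mathcomp Require Import all_boot all_order all_algebra.
From mathcomp Require Import all_classical all_reals all_analysis.
From mathcomp Require Import complex.

Set Implicit Arguments.
Unset Strict Implicit.
Unset Printing Implicit Defensive.

Import Order.TTheory GRing.Theory Num.Theory.
Import numFieldNormedType.Exports.

Local Open Scope classical_set_scope.
Local Open Scope ring_scope.

(* A C*-algebra need not have a unit, so its product cannot be the one of a
   MathComp ring type: it is an operation of the structure, like the
   involution. The norm takes its values in R[i], where 0 <= z forces z to be
   real. *)
HB.mixin Record isCStarAlgebra (R : realType) A
    & CompleteNormedModule R[i] A := {
  cmul : A -> A -> A ;
  star : A -> A ;
  cmulA : forall x y z, cmul x (cmul y z) = cmul (cmul x y) z ;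
  cmulDl : forall x y z, cmul (x + y) z = cmul x z + cmul y z ;
  cmulDr : forall x y z, cmul x (y + z) = cmul x y + cmul x z ;
  cmulZl : forall (a : R[i]) x y, cmul (a *: x) y = a *: cmul x y ;
  cmulZr : forall (a : R[i]) x y, cmul x (a *: y) = a *: cmul x y ;
  starK : forall x, star (star x) = x ;
  starD : forall x y, star (x + y) = star x + star y ;
  starZ : forall (a : R[i]) x, star (a *: x) = conjc a *: star x ;
  starM : forall x y, star (cmul x y) = cmul (star y) (star x) ;
  norm_cmul_le : forall x y, `|cmul x y| <= `|x| * `|y| ;
  norm_star_cmul : forall x, `|cmul (star x) x| = `|x| ^+ 2
}.

#[short(type="cstarAlgType")]
HB.structure Definition CStarAlgebra (R : realType) :=
  {A of CompleteNormedModule R[i] A & isCStarAlgebra R A}.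

Declare Scope cstar_scope.
Delimit Scope cstar_scope with cstar.
Notation "x *c y" := (cmul x y)
  (at level 40, left associativity) : cstar_scope.
Local Open Scope cstar_scope.

Definition sub_cstar (R : realType) (A : cstarAlgType R) (S : set A) : Prop :=
  [/\ S 0,
      forall x y, S x -> S y -> S (x + y),
      forall (a : R[i]) x, S x -> S (a *: x),
      forall x y, S x -> S y -> S (x *c y) &
      forall x, S x -> S (star x)] /\
  closed S.

(* A homomorphism from S to B is represented by a total function on A of which
   only the values on S matter. No continuity is required. *)
Definition star_hom_on (R : realType) (A B : cstarAlgType R) (S : set A)
    (f : A -> B) : Prop :=
  [/\ forall x y, S x -> S y -> f (x + y) = f x + f y,
      forall (a : R[i]) x, S x -> f (a *: x) = a *: f x,
      forall x y, S x -> S y -> f (x *c y) = f x *c f y &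
      forall x, S x -> f (star x) = star (f x)].

Definition star_hom (R : realType) (A B : cstarAlgType R) (f : A -> B) : Prop :=
  star_hom_on setT f.

Definition lin_span (K : pzRingType) (V : lmodType K) (S : set V) : set V :=
  [set x | exists (n : nat) (c : 'I_n -> K) (v : 'I_n -> V),
     (forall k, S (v k)) /\ x = \sum_(k < n) c k *: v k].

Definition linearly_independent_family (I : choiceType) (V : zmodType)
    (A : I -> set V) : Prop :=
  forall S : I -> V, (forall i, A i (S i)) ->
    finite_set [set i | S i != 0] -> \sum_(i \in [set: I]) S i = 0 ->
    forall i, S i = 0.

Definition total_family (R : realType) (I : Type) (A : cstarAlgType R)
    (F : I -> set A) : Prop :=
  dense (lin_span (\bigcup_i F i)).

Definition graded (R : realType) (d : Order.disp_t)
    (L : meetSemilatticeType d) (A : cstarAlgType R) (F : L -> set A) : Prop :=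
  [/\ forall i, sub_cstar (F i),
      linearly_independent_family F,
      total_family F &
      forall i j x y, F i x -> F j y -> F (i `&` j)%O (x *c y)].

(* Main.v *)
Require Import Defs.
From HB Require Import structures.
From mathcomp Require Import all_boot all_order all_algebra.
From mathcomp Require Import all_classical all_reals all_analysis.
From mathcomp Require Import cyclic separable cyclotomic complex.
From mathcomp Require Import zify ring lra.

Set Implicit Arguments.
Unset Strict Implicit.
Unset Printing Implicit Defensive.

Import Order.TTheory GRing.Theory Num.Theory Normc.
Import numFieldNormedType.Exports.

Local Open Scope classical_set_scope.
Local Open Scope ring_scope.
Local Open Scope complex_scope.
Local Open Scope cstar_scope.

(** Both halves of the theorem rest on one automatic continuity fact,
    [star_hom_on_nrm_le]: a star-homomorphism on a closed star-subalgebra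
    satisfies |f x| <= 2 |x|.  If b is self-adjoint and |b| <= 1/2, a contraction
    argument inside the subalgebra gives a self-adjoint w commuting with b such
    that (1 - w)^2 = 1 - b^2.  These are algebraic relations, so f b and f w
    satisfy them too; hence f b + i (1 - f w) acts isometrically on the target,
    its real part f b has norm at most 1, and scaling together with the
    C*-identity gives the bound.

    Uniqueness follows at once: two solutions are Lipschitz and agree on the
    dense span of the components.  For existence, linear independence makes
    sum_i x_i |-> sum_i psi_i(x_i) a well defined star-homomorphism on that span
    ([graph_fun], [graph_map_star_hom]); once it is known to be bounded, it
    extends by continuity ([star_hom_extension]).  Every element of the span lies
    in some A_F = sum_(i in F) A_i with F finite and stable under meets.  If A_F
    is closed it is a sub-C*-algebra, and the bound 2, which does not depend on F,
    comes from automatic continuity.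

    That A_F is closed is proved by induction on F ([component_nrm_le]).  Let m be
    maximal in F.  The other components span an ideal J of A_F, closed by
    induction, and A_m meets J in 0, so it is enough to bound the projection of
    A_m + J onto A_m; this is [nrm_le_add_ideal]: |a| <= 2 |a + d| for a in A_m and
    d in J.  For self-adjoint a and d, scaled so that |a| <= 1/2, put x = a + d and
    r = 2 |x|; only r < 1 needs an argument.  Take real polynomials g_n tending
    uniformly on [-1, 1] to max(0, t^2 - r^2).  Then g_n(x) x tends to 0 and
    g_n(a) a converges in A_m, while their difference stays in J; so lim g_n(a) a
    lies in A_m and in J, and vanishes.  As |t^2 - g_n(t)| is at most about r^2,
    this forces |a^3| <= r^2 |a|, that is |a| <= r.

    What makes this work is the estimate |p(b) z| <= M |z| for a real polynomial p
    bounded by M on [-tau, tau] and b self-adjoint with |b| <= tau / 2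
    ([nrm_fcalc_le]).  By the square root above, b = tau (u + u^-1) / 2 with u
    isometric, so u^n p(b) is a polynomial in u of degree at most 2n.  Its
    coefficients are Fourier coefficients of a function bounded by M, hence
    |p(b) z| <= (2n + 1) M |z|.  Applying this to the powers p^(2^k) and using the
    C*-identity removes the factor 2n + 1. *)

(** * Real-valued norms and sequences *)

Lemma invSn_lt (R : realType) (e : R) : 0 < e ->
  exists N, forall n, (N <= n)%N -> n.+1%:R^-1 < e.
Proof.
move=> e0; have [N _ hN] := near_infty_natSinv_lt (PosNum e0).
by exists N => n /hN.
Qed.

Section RealNorm.
Variables (R : realType) (A : cstarAlgType R).
Implicit Types (x y z : A) (a : R[i]).

(** The norm of the structure is a nonnegative element of R[i]; its real part
    carries the same information and lives in a totally ordered field. *)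
Definition nrm x : R := complex.Re `|x|.

Lemma nrmE x : `|x| = (nrm x)%:C.
Proof. by rewrite /nrm RRe_real // ger0_real. Qed.

Lemma nrm_ge0 x : 0 <= nrm x.
Proof. by rewrite -ler0c -nrmE. Qed.

Lemma nrm0 : nrm 0 = 0.
Proof. by apply: complexI; rewrite -nrmE normr0. Qed.

Lemma nrm_eq0 x : nrm x = 0 -> x = 0.
Proof. by move=> h; apply/eqP; rewrite -normr_eq0 nrmE h. Qed.

Lemma nrmN x : nrm (- x) = nrm x.
Proof. by rewrite /nrm normrN. Qed.

Lemma nrm_distC x y : nrm (x - y) = nrm (y - x).
Proof. by rewrite /nrm distrC. Qed.

Lemma nrmD x y : nrm (x + y) <= nrm x + nrm y.
Proof. by rewrite -lecR rmorphD /= -!nrmE ler_normD. Qed.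

Lemma nrmB x y : nrm (x - y) <= nrm x + nrm y.
Proof. by rewrite -(nrmN y) nrmD. Qed.

Lemma nrm_sum (I : Type) (r : seq I) (P : pred I) (F : I -> A) :
  nrm (\sum_(i <- r | P i) F i) <= \sum_(i <- r | P i) nrm (F i).
Proof.
elim/big_rec2: _ => [|i s x _ h]; first by rewrite nrm0.
by rewrite (le_trans (nrmD _ _)) // lerD2l.
Qed.

Lemma norm_normc a : `|a| = (normc a)%:C.
Proof. by rewrite normc_def; case: a. Qed.

Lemma normcR (r : R) : normc r%:C = `|r|.
Proof. by rewrite /normc /= expr0n addr0 sqrtr_sqr. Qed.

Lemma nrmZ a x : nrm (a *: x) = normc a * nrm x.
Proof. by apply: complexI; rewrite -nrmE normrZ norm_normc nrmE rmorphM. Qed.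

Lemma nrmZr (r : R) x : nrm (r%:C *: x) = `|r| * nrm x.
Proof. by rewrite nrmZ normcR. Qed.

Lemma nrmM_le x y : nrm (x *c y) <= nrm x * nrm y.
Proof. by rewrite -lecR rmorphM /= -!nrmE norm_cmul_le. Qed.

Lemma nrm_star_cmul x : nrm (star x *c x) = nrm x ^+ 2.
Proof. by apply: complexI; rewrite -nrmE norm_star_cmul nrmE rmorphXn. Qed.

(** From |x|^2 = |x^* x| <= |x^*| |x|, applied to x and to x^*. *)
Lemma nrm_star x : nrm (star x) = nrm x.
Proof.
suff le_star y : nrm y <= nrm (star y).
  by apply/le_anti; rewrite le_star andbT; have := le_star (star x); rewrite starK.
have := nrm_star_cmul y; have := nrmM_le (star y) y.
have := nrm_ge0 y; have := nrm_ge0 (star y).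
by nra.
Qed.

Fact cmul_is_linear x : linear (cmul x).
Proof. by move=> a y z; rewrite cmulDr cmulZr. Qed.

HB.instance Definition _ x :=
  GRing.isLinear.Build R[i] A A *:%R (cmul x) (cmul_is_linear x).

Definition cmulr y x := x *c y.

Fact cmulr_is_linear y : linear (cmulr y).
Proof. by move=> a x z; rewrite /cmulr cmulDl cmulZl. Qed.

HB.instance Definition _ y :=
  GRing.isLinear.Build R[i] A A *:%R (cmulr y) (cmulr_is_linear y).

Fact star_is_additive : additive (@star R A).
Proof.
move=> x y; rewrite starD; congr (_ + _).
by rewrite -scaleN1r starZ rmorphN1 scaleN1r.
Qed.

HB.instance Definition _ :=
  GRing.isAdditive.Build A A (@star R A) star_is_additive.

Lemma cmul0l x : 0 *c x = 0. Proof. exact: (raddf0 (cmulr x)). Qed.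
Lemma cmul0r x : x *c 0 = 0. Proof. exact: raddf0. Qed.
Lemma cmulBl x y z : (x - y) *c z = x *c z - y *c z.
Proof. exact: (raddfB (cmulr z)). Qed.
Lemma cmulBr x y z : z *c (x - y) = z *c x - z *c y.
Proof. exact: raddfB. Qed.
Lemma cmul_suml (I : Type) (r : seq I) (P : pred I) (F : I -> A) x :
  (\sum_(i <- r | P i) F i) *c x = \sum_(i <- r | P i) F i *c x.
Proof. exact: (raddf_sum (cmulr x)). Qed.
Lemma cmul_sumr (I : Type) (r : seq I) (P : pred I) (F : I -> A) x :
  x *c (\sum_(i <- r | P i) F i) = \sum_(i <- r | P i) x *c F i.
Proof. exact: raddf_sum. Qed.

Lemma starZr (r : R) x : star (r%:C *: x) = r%:C *: star x.
Proof. by rewrite starZ conjc_real. Qed.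

Lemma nrm_sqr x : star x = x -> nrm (x *c x) = nrm x ^+ 2.
Proof. by move=> sx; rewrite -nrm_star_cmul sx. Qed.

Lemma cvg_nrmP (u : nat -> A) (l : A) :
  (u @ \oo --> l) <-> forall e : R, 0 < e -> \forall n \near \oo, nrm (u n - l) < e.
Proof.
split=> [ul e e0|h].
  have /cvgrPdist_lt/(_ e%:C) := ul; rewrite ltcR => /(_ e0).
  by apply: filterS => n; rewrite nrm_distC nrmE ltcR.
apply/cvgrPdist_lt => e e0.
have eE : (complex.Re e)%:C = e by rewrite RRe_real // gtr0_real.
have {}e0 : 0 < complex.Re e by rewrite -ltcR eE.
by apply: filterS (h _ e0) => n; rewrite nrm_distC nrmE -{2}eE ltcR.
Qed.

Lemma cauchy_nrm_cvg (u : nat -> A) :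
  (forall e : R, 0 < e -> exists N, forall m n, (N <= m)%N -> (N <= n)%N ->
     nrm (u m - u n) < e) -> cvgn u.
Proof.
move=> h; apply: cauchy_cvg; apply: cauchy_exP => e e0.
have eE : (complex.Re e)%:C = e by rewrite RRe_real // gtr0_real.
have {}e0 : 0 < complex.Re e by rewrite -ltcR eE.
have [N hN] := h _ e0; exists (u N); exists N => // n /= Nn.
by rewrite -ball_normE /ball_ /= nrmE -eE ltcR hN.
Qed.

Lemma dense_nrmP (D : set A) : dense D ->
  forall x (e : R), 0 < e -> exists2 y, D y & nrm (x - y) < e.
Proof.
move=> dD x e e0.
have eC : 0 < e%:C by rewrite ltcR.
have [||y [/= By Dy]] := dD (ball x e%:C).
- by exists x; apply: ballxx.
- exact: ball_open.
by exists y => //; move: By; rewrite -ball_normE /ball_ /= nrmE ltcR.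
Qed.

Lemma nrm_closed (D : set A) :
  (forall x, (forall e : R, 0 < e -> exists2 y, D y & nrm (x - y) < e) -> D x) ->
  closed D.
Proof.
move=> h x cx; apply: h => e e0.
have eC : 0 < e%:C by rewrite ltcR.
have [y [Dy]] := cx _ (nbhsx_ballx x _ eC).
by rewrite -ball_normE /ball_ /= nrmE ltcR => hy; exists y.
Qed.

Lemma cvg_cmul (u v : nat -> A) (l m : A) :
  u @ \oo --> l -> v @ \oo --> m -> (fun n => u n *c v n) @ \oo --> l *c m.
Proof.
move=> /cvg_nrmP ul /cvg_nrmP vm; apply/cvg_nrmP => e e0.
have K0 : 0 < 1 + nrm l + nrm m by have := nrm_ge0 l; have := nrm_ge0 m; lra.
set K := _ + _ in K0.
pose d := Num.min 1 (e / (2 * K)).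
have d0 : 0 < d by rewrite lt_min ltr01 divr_gt0 // mulr_gt0.
have d1 : d <= 1 by rewrite ge_min lexx.
have dK : d * K <= e / 2.
  have : d <= e / (2 * K) by rewrite ge_min lexx orbT.
  by move=> /(ler_wpM2r (ltW K0)) /le_trans; apply; rewrite invfM mulrA divfK // gt_eqF.
near=> n.
have hu : nrm (u n - l) < d by near: n; exact: ul.
have hv : nrm (v n - m) < d by near: n; exact: vm.
have -> : u n *c v n - l *c m = (u n - l) *c v n + l *c (v n - m).
  by rewrite cmulBl cmulBr addrA subrK.
have hvn : nrm (v n) <= nrm m + 1.
  rewrite -(subrK m (v n)) addrC; apply: le_trans (nrmD _ _) _.
  by rewrite lerD2l (le_trans (ltW hv)).
apply: le_lt_trans (nrmD _ _) _.
have h1 : nrm ((u n - l) *c v n) <= d * (nrm m + 1).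
  by apply: le_trans (nrmM_le _ _) _; rewrite ler_pM ?nrm_ge0 // ltW.
have h2 : nrm (l *c (v n - m)) <= nrm l * d.
  by apply: le_trans (nrmM_le _ _) _; rewrite ler_pM ?nrm_ge0 // ltW.
by move: dK; rewrite /K; lra.
Unshelve. all: by end_near.
Qed.
End RealNorm.

Lemma cvg_sum_seq (R : realType) (A : cstarAlgType R) (I : eqType) (r : seq I)
    (u : nat -> I -> A) (l : I -> A) :
  (forall i, i \in r -> (fun n => u n i) @ \oo --> l i) ->
  (fun n => \sum_(i <- r) u n i) @ \oo --> \sum_(i <- r) l i.
Proof.
elim: r => [|i r IH] h.
  by rewrite big_nil; under eq_fun do rewrite big_nil; exact: cvg_cst.
rewrite big_cons; under eq_fun do rewrite big_cons.
apply: cvgD; first by apply: h; rewrite mem_head.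
by apply: IH => j jr; apply: h; rewrite inE jr orbT.
Qed.


(** * Square roots and boundedness of homomorphisms *)

Section SquareRoot.
Variables (R : realType) (A : cstarAlgType R).
Implicit Types (x y z : A) (a : R[i]).

Lemma seq_cvg_unique (u : nat -> A) (l m : A) :
  u @ \oo --> l -> u @ \oo --> m -> l = m.
Proof. exact: norm_cvg_unique. Qed.

Lemma cvg_star (u : nat -> A) (l : A) :
  u @ \oo --> l -> (fun n => star (u n)) @ \oo --> star l.
Proof.
move=> /cvg_nrmP ul; apply/cvg_nrmP => e e0.
by apply: filterS (ul e e0) => n; rewrite -raddfB nrm_star.
Qed.

Lemma geometric_nrm_cvg (u : nat -> A) :
  (forall n, nrm (u n.+1 - u n) <= 2^-1 ^+ n) -> cvgn u.
Proof.
move=> h.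
have tail n k : nrm (u (n + k)%N - u n) <= 2 * 2^-1 ^+ n - 2 * 2^-1 ^+ (n + k).
  elim: k => [|k IH]; first by rewrite addn0 !subrr nrm0.
  rewrite addnS -(subrK (u (n + k)%N) (u (n + k).+1)) -addrA.
  apply: le_trans (nrmD _ _) _; rewrite exprS.
  by have := h (n + k)%N; lra.
have pos n : 0 < 2^-1 ^+ n :> R by rewrite exprn_gt0 // invr_gt0.
apply: cauchy_nrm_cvg => e e0.
have [N _ hN] : \forall n \near \oo, 2^-1 ^+ n < e / 4 :> R.
  have /cvgr_lt : (fun n => 2^-1 ^+ n : R) @ \oo --> (0 : R).
    by apply: cvg_expr; rewrite ger0_norm ?invr_ge0 // invf_lt1 // ltr1n.
  by apply; rewrite divr_gt0.
have to_N m : (N <= m)%N -> nrm (u m - u N) < e / 2.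
  move=> Nm; have := tail N (m - N)%N; rewrite subnKC // => tl.
  by have := hN N (leqnn N); have := pos m; rewrite /=; lra.
exists N => m n Nm Nn.
rewrite -(subrK (u N) (u m)) -addrA; apply: le_lt_trans (nrmD _ _) _.
by rewrite (nrm_distC (u N)); have := to_N m Nm; have := to_N n Nn; lra.
Qed.

Lemma sub_cstarT : sub_cstar [set: A].
Proof. by split; [split | exact: closedT]. Qed.

Lemma sub_cstar_cvg (S : set A) (u : nat -> A) (l : A) :
  sub_cstar S -> (forall n, S (u n)) -> u @ \oo --> l -> S l.
Proof. case=> _ cS Su ul; apply: (@closed_cvg _ _ \oo _ u S cS _ l ul).
exact: nearW. Qed.

(** The equation says (1 - w)^2 = 1 - b^2 without mentioning a unit.  Its solution
    is the limit of the iterates of w |-> (b^2 + w^2) / 2 starting from 0: they stay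
    in the ball of radius 1/4, where this map is a contraction, and they inherit
    self-adjointness and commutation with b. *)
Lemma half_sqrt_exists (S : set A) b : sub_cstar S -> S b -> star b = b ->
  nrm b <= 2^-1 ->
  exists w, [/\ S w, star w = w, b *c w = w *c b & w + w = b *c b + w *c w].
Proof.
move=> SS Sb sb b2; have [[S0 SD SZ SM _] _] := SS.
pose f w := 2^-1%:C *: (b *c b + w *c w).
pose w n := iter n f 0.
have wS n : w n.+1 = f (w n) by [].
have Sw n : S (w n) by elim: n => // n IH; apply/SZ/SD; apply: SM.
have sw n : star (w n) = w n.
  by elim: n => [|n IH]; rewrite ?raddf0 // wS starZr raddfD /= !starM sb IH.
have cw n : b *c w n = w n *c b.
  elim: n => [|n IH]; first by rewrite cmul0l cmul0r.
  rewrite wS cmulZl cmulZr; congr (_ *: _).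
  by rewrite cmulDl cmulDr !cmulA IH -!cmulA IH.
have half0 : (0 : R) <= 2^-1 by rewrite invr_ge0.
have nw n : nrm (w n) <= 4^-1.
  elim: n => [|n IH]; first by rewrite nrm0 invr_ge0.
  rewrite wS nrmZr ger0_norm //.
  have := nrmD (b *c b) (w n *c w n); rewrite !nrm_sqr //.
  by have := nrm_ge0 (w n); have := nrm_ge0 b; nra.
have dw n : nrm (w n.+1 - w n) <= 2^-1 ^+ n.
  elim: n => [|n IH].
    rewrite subr0 expr0; apply: le_trans (nw 1%N) _; lra.
  rewrite wS [in X in nrm (_ - X)]wS /f -scalerBr opprD addrACA subrr add0r.
  rewrite nrmZr ger0_norm //.
  have -> : w n.+1 *c w n.+1 - w n *c w n =
      w n.+1 *c (w n.+1 - w n) + (w n.+1 - w n) *c w n.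
    by rewrite cmulBl cmulBr addrA subrK.
  have := nrmD (w n.+1 *c (w n.+1 - w n)) ((w n.+1 - w n) *c w n).
  have := nrmM_le (w n.+1) (w n.+1 - w n); have := nrmM_le (w n.+1 - w n) (w n).
  have := nw n; have := nw n.+1; have := nrm_ge0 (w n.+1 - w n).
  have := nrm_ge0 (w n.+1); have := nrm_ge0 (w n).
  rewrite exprS; move: IH.
  set d := nrm (w n.+1 - w n); set p := nrm (w n.+1); set q := nrm (w n) => *.
  have : p * d <= 4^-1 * d by rewrite ler_wpM2r.
  have : d * q <= d * 4^-1 by rewrite ler_wpM2l.
  lra.
have /cvg_ex[l wl] := geometric_nrm_cvg dw.
exists l; split.
- exact: sub_cstar_cvg Sw wl.
- apply: (seq_cvg_unique (u := w)) (wl); have := cvg_star wl.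
  by under eq_fun do rewrite sw.
- apply: (seq_cvg_unique (cvg_cmul (cvg_cst b) wl)).
  by under eq_fun do rewrite cw; exact: cvg_cmul wl (cvg_cst b).
- apply: (seq_cvg_unique (u := fun n => w n.+1 + w n.+1)).
    by apply: cvgD; rewrite cvg_shiftS.
  under eq_fun do rewrite wS /f -scalerDl -rmorphD /=.
  rewrite (_ : 2^-1 + 2^-1 = 1 :> R); last lra.
  under eq_fun do rewrite scale1r.
  by apply: cvgD; [exact: cvg_cst | exact: cvg_cmul].
Qed.

End SquareRoot.

Section Unitary.
Variables (R : realType) (B : cstarAlgType R) (b w : B).
Hypotheses (sb : star b = b) (sw : star w = w) (bw : b *c w = w *c b).
Hypothesis w2 : w + w = b *c b + w *c w.
Implicit Types (x y z : B) (j : R[i]).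

(** Left multiplication by b + j (1 - w), the element of the unitization that is
    unitary when j is i or -i. *)
Definition unitary_act j z := b *c z + j *: (z - w *c z).

(** Because b and w commute, the product of b - j (1 - w) and b + j (1 - w) is
    b^2 + (1 - w)^2 = 1. *)
Lemma unitary_actN j z : j * j = -1 ->
  unitary_act (- j) (unitary_act j z) = z.
Proof.
move=> jj; rewrite /unitary_act; set s := z - w *c z.
have bs : b *c s = b *c z - w *c (b *c z) by rewrite cmulBr !cmulA bw.
have ss : s - w *c s = z - b *c (b *c z).
  rewrite /s cmulBr opprB addrA addrAC -[_ - _ - _]addrA -opprD.
  by rewrite cmulA cmulA -!cmulDl w2 cmulDl opprD addrA subrK.
rewrite !cmulDr !cmulZr opprD addrACA -scalerBr ss -bs.
by rewrite scalerDr scalerA mulNr jj opprK scale1r scaleNr addrA addrK addrC subrK.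
Qed.

Lemma star_unitary_act j x y : conjc j = - j ->
  star (unitary_act j x) *c y = star x *c unitary_act (- j) y.
Proof.
move=> cj; rewrite /unitary_act raddfD /= starZ raddfB /= !starM sb sw cj.
by rewrite cmulDl cmulZl cmulBl cmulDr cmulZr cmulBr !cmulA.
Qed.

Lemma nrm_unitary_act j z : j * j = -1 -> conjc j = - j ->
  nrm (unitary_act j z) = nrm z.
Proof.
move=> jj cj; apply/eqP; rewrite -(@eqrXn2 _ 2) ?nrm_ge0 //.
by rewrite -!nrm_star_cmul star_unitary_act // unitary_actN.
Qed.

Lemma conjc_i : conjc 'i = - 'i :> R[i]. Proof. by simpc. Qed.
Lemma mul_ii : 'i * 'i = -1 :> R[i]. Proof. by rewrite -expr2 sqr_i. Qed.

(** b is the half-sum of the two isometries for j = i and j = -i. *)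
Lemma nrm_cmul_unitary_part z : nrm (b *c z) <= nrm z.
Proof.
have e : (2^-1)%:C *: (unitary_act 'i z + unitary_act (- 'i) z) = b *c z.
  rewrite /unitary_act scaleNr addrACA subrr addr0 -{1 2}(scale1r (b *c z)).
  rewrite -scalerDl scalerA -(rmorph1 (real_complex R)) -rmorphD -rmorphM /=.
  by rewrite mulVf ?scale1r // pnatr_eq0.
rewrite -{}e nrmZr ger0_norm ?invr_ge0 //.
have := nrmD (unitary_act 'i z) (unitary_act (- 'i) z).
have conjc_Ni : conjc (- 'i) = - - 'i :> R[i] by rewrite rmorphN; congr (- _); exact: conjc_i.
by rewrite !nrm_unitary_act ?mulrNN ?mul_ii ?conjc_i //; lra.
Qed.

Lemma nrm_unitary_part : nrm b <= 1.
Proof.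
have := nrm_cmul_unitary_part b; rewrite nrm_sqr //.
have := nrm_ge0 b; nra.
Qed.

End Unitary.

Section HomBound.
Variables (R : realType) (A B : cstarAlgType R).

(** The square root of 1 - x^2 is found in the source, where the norm of x is
    known; the target only sees the resulting algebraic relations. *)
Lemma star_hom_on_nrm_le (S : set A) (f : A -> B) :
  sub_cstar S -> star_hom_on S f -> forall x, S x -> nrm (f x) <= 2 * nrm x.
Proof.
move=> SS [fD fZ fM fs]; have [[S0 SD SZ SM Ss] _] := SS.
have small b : S b -> star b = b -> nrm b <= 2^-1 -> nrm (f b) <= 1.
  move=> Sb sb b2; have [w [Sw sw bw w2]] := half_sqrt_exists SS Sb sb b2.
  apply: (@nrm_unitary_part _ _ _ (f w)); first by rewrite -fs // sb.
  - by rewrite -fs // sw.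
  - by rewrite -!fM // bw.
  - by rewrite -!fM // -!fD //; [rewrite w2| exact: SM| exact: SM].
have f0 : f 0 = 0 by rewrite -(scale0r (0 : A)) fZ // scale0r.
have sa b : S b -> star b = b -> nrm (f b) <= 2 * nrm b.
  move=> Sb sb; have [/nrm_eq0->|b0] := eqVneq (nrm b) 0.
    by rewrite f0 !nrm0 mulr0.
  have bp : 0 < nrm b by rewrite lt_neqAle eq_sym b0 nrm_ge0.
  pose r := (2 * nrm b)^-1.
  have r0 : 0 < r by rewrite invr_gt0 mulr_gt0.
  have := small (r%:C *: b) (SZ _ _ Sb).
  rewrite starZr sb nrmZr fZ // nrmZr !gtr0_norm // => /(_ erefl).
  have rb : r * nrm b = 2^-1 by rewrite /r invfM mulfVK.
  rewrite rb => /(_ (lexx _)) h.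
  by rewrite -(ler_pM2l r0) mulrCA rb mulfV ?pnatr_eq0.
move=> x Sx.
have := sa (star x *c x) (SM _ _ (Ss _ Sx) Sx).
rewrite starM starK fM ?fs ?nrm_star_cmul //; last exact: Ss.
move=> /(_ erefl); have := nrm_ge0 x; have := nrm_ge0 (f x); nra.
Qed.

End HomBound.

(** * Polynomials in a self-adjoint element *)

Section Fourier.

Lemma prim_root_exists (F : closedFieldType) (n : nat) :
  n%:R != 0 :> F -> exists z : F, n.-primitive_root z.
Proof.
move=> nF; have n0 : (0 < n)%N by rewrite lt0n; apply: contraNneq nF => ->.
have [r rE] := closed_field_poly_normal ('X^n - 1 : {poly F}).
rewrite (monicP _) ?monicXnsubC // scale1r in rE.
suff /hasP[z _ zn] : has n.-primitive_root r by exists z.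
apply: has_prim_root => //.
- by apply/allP => z; rewrite -root_prod_XsubC -rE.
- by rewrite -separable_prod_XsubC -rE separable_Xn_sub_1.
- by rewrite -ltnS -(size_prod_XsubC r id) -rE size_XnsubC.
Qed.

Lemma sum_unity_root_expr (F : fieldType) (n : nat) (x : F) :
  x ^+ n = 1 -> x != 1 -> \sum_(j < n) x ^+ j = 0.
Proof.
move=> xn x1; apply: (mulfI (x := x - 1)); first by rewrite subr_eq0.
by rewrite -subrX1 xn subrr mulr0.
Qed.

(** Discrete Fourier inversion: with w a primitive n-th root of unity and
    n = size p, n p_k is the sum over j < n of p(w^j) w^(-jk). *)
Lemma norm_coef_le (R : rcfType) (p : {poly R[i]}) (M : R[i]) :
  (forall z, `|z| = 1 -> `|p.[z]| <= M) -> forall k, `|p`_k| <= M.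
Proof.
move=> pM k.
have M0 : 0 <= M by apply: le_trans (pM 1 (normr1 _)); rewrite normr_ge0.
have [kp|kp] := ltnP k (size p); last by rewrite nth_default // normr0.
set n := size p in kp *; have n0 : (0 < n)%N by apply: leq_ltn_trans kp.
have nF : n%:R != 0 :> R[i] by rewrite pnatr_eq0 -lt0n.
have [w wn] := prim_root_exists nF.
have w1 : `|w| = 1.
  apply/eqP; rewrite -(pexpr_eq1 (n := n)) //.
  by rewrite -normrX (prim_expr_order wn) normr1.
(* w ^+ (j * (n - k)) is w ^ (- j k), as w ^+ n = 1 *)
have key : \sum_(j < n) p.[w ^+ j] * w ^+ (j * (n - k)) = n%:R * p`_k.
  transitivity (\sum_(m < n) p`_m * \sum_(j < n) (w ^+ (m + (n - k))) ^+ j).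
    under eq_bigr do rewrite horner_coef mulr_suml.
    rewrite exchange_big; apply: eq_bigr => m _; rewrite mulr_sumr.
    apply: eq_bigr => j _; rewrite -!exprM -mulrA -exprD; congr (_ * _ ^+ _).
    by rewrite mulnDl (mulnC m) (mulnC (n - k)%N).
  rewrite (bigD1 (Ordinal kp)) //= [X in _ + X]big1 => [|m mk].
    rewrite addr0 subnKC ?(ltnW kp) // (prim_expr_order wn).
    by under eq_bigr do rewrite expr1n; rewrite sumr_const card_ord mulrC.
  rewrite sum_unity_root_expr ?mulr0 //.
    by rewrite -exprM mulnC exprM (prim_expr_order wn) expr1n.
  apply: contra mk => /eqP wm1; apply/eqP/val_inj => /=.
  have /eqP : w ^+ (m + (n - k)) = w ^+ 0 by rewrite wm1.
  rewrite (eq_prim_root_expr wn) -(eqn_modDr k) -addnA subnK ?(ltnW kp) // modnDr.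
  by rewrite add0n !modn_small // => /eqP.
rewrite -(ler_pM2l (x := n%:R)) ?ltr0n // -[X in X * _]normr_nat -normrM -key.
apply: le_trans (ler_norm_sum _ _ _) _.
rewrite mulr_natl -[X in M *+ X]card_ord -sumr_const.
apply: ler_sum => j _; rewrite normrM !normrX w1 !expr1n mulr1.
by rewrite pM // normrX w1 expr1n.
Qed.

(** If x > M > 0, then x / M = 1 + d with d > 0, and Bernoulli's inequality makes
    (x / M)^(2 m) at least (1 + m d)^2, which outgrows every affine function of m. *)
Lemma le_of_pow2_le (R : realType) (x M c : R) : 0 <= M ->
  (forall k, x ^+ (2 ^ k) <= (c * (2 ^ k)%:R + 1) * M ^+ (2 ^ k)) -> x <= M.
Proof.
move=> M0 h; rewrite leNgt; apply/negP => Mx.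
have [Me|Mp] := eqVneq M 0.
  by have := h 0%N; rewrite expn0 !expr1 Me mulr0 leNgt -Me Mx.
have {}Mp : 0 < M by rewrite lt_neqAle eq_sym Mp.
pose d := x / M - 1.
have d0 : 0 < d by rewrite subr_gt0 ltr_pdivlMr // mul1r.
have hd k : (1 + d) ^+ (2 ^ k) <= c * (2 ^ k)%:R + 1.
  by rewrite /d addrC subrK expr_div_n ler_pdivrMr ?exprn_gt0 // h.
have bern n : 1 + n%:R * d <= (1 + d) ^+ n.
  elim: n => [|n IH]; first by rewrite mul0r addr0 expr0.
  rewrite exprS -natr1; have : 0 <= n%:R :> R by []. 
  by set q := (1 + d) ^+ n in IH *; set m := n%:R in IH *; nra.
have bound k : (2 ^ k)%:R <= 2 * c / d ^+ 2.
  have := hd k.+1; rewrite expnS mulnC exprM; have := bern (2 ^ k)%N.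
  have : 0 < (2 ^ k)%:R :> R by rewrite ltr0n expn_gt0.
  rewrite natrM ler_pdivlMr ?exprn_gt0 //.
  set q := (1 + d) ^+ _; set m := (2 ^ k)%:R => m0 b1 b2.
  have : (1 + m * d) ^+ 2 <= q ^+ 2.
    by rewrite ler_pXn2r // nnegrE; nra.
  move=> b3; have {b1 b2 b3}: 2 * m * d + m * (m * d ^+ 2) <= m * (2 * c).
    by have := le_trans b3 b2; nra.
  move=> b4; rewrite -(ler_pM2l m0); apply: le_trans b4.
  by rewrite lerDr; nra.
have [N hN] : exists N : nat, 2 * c / d ^+ 2 < N%:R.
  by exists (Num.truncn (2 * c / d ^+ 2)).+1; rewrite truncnS_gt.
have := le_lt_trans (bound N) hN; rewrite ltr_nat ltnNge.
by rewrite ltnW // ltn_expl.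
Qed.

End Fourier.

Section PolyAction.
Variables (K : comNzRingType) (V : lmodType K) (T : {linear V -> V}).
Implicit Types (p q : {poly K}) (z : V) (c : K).

(** p(S) z. *)
Definition poly_act (S : V -> V) p z := \sum_(i < size p) p`_i *: iter i S z.

Lemma poly_act_wide (S : V -> V) p n z : (size p <= n)%N ->
  poly_act S p z = \sum_(i < n) p`_i *: iter i S z.
Proof.
move=> pn; rewrite /poly_act (big_ord_widen n (fun i => p`_i *: iter i S z)) //.
rewrite big_mkcond; apply: eq_bigr => i _.
by case: ltnP => // pi; rewrite nth_default // scale0r.
Qed.

Lemma poly_actD p q z : poly_act T (p + q) z = poly_act T p z + poly_act T q z.
Proof.
set n := maxn (size p) (size q).
rewrite !(@poly_act_wide _ _ n) ?leq_maxl ?leq_maxr ?size_polyD //.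
by rewrite -big_split; apply: eq_bigr => i _; rewrite coefD scalerDl.
Qed.

Lemma poly_actZ c p z : poly_act T (c *: p) z = c *: poly_act T p z.
Proof.
rewrite !(@poly_act_wide _ _ (size p)) ?size_scale_leq // scaler_sumr.
by apply: eq_bigr => i _; rewrite coefZ scalerA.
Qed.

Lemma poly_actC c z : poly_act T c%:P z = c *: z.
Proof.
by rewrite (@poly_act_wide _ _ 1) ?size_polyC_leq1 // big_ord1 coefC.
Qed.

Lemma poly_actMX p z : poly_act T (p * 'X) z = poly_act T p (T z).
Proof.
rewrite (@poly_act_wide _ _ (size p).+1); last first.
  by apply: leq_trans (size_polyMleq _ _) _; rewrite size_polyX addn2.
rewrite big_ord_recl coefMX eqxx scale0r add0r; apply: eq_bigr => i _.
by rewrite coefMX /= -iterSr.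
Qed.

Lemma poly_act0 z : poly_act T 0 z = 0.
Proof. by have := poly_actZ 0 0 z; rewrite !scale0r. Qed.

Lemma poly_act1 z : poly_act T 1 z = z.
Proof. by rewrite -[1]/(1%:P) poly_actC scale1r. Qed.

Lemma poly_actB p q z : poly_act T (p - q) z = poly_act T p z - poly_act T q z.
Proof. by rewrite poly_actD -[- q]scaleN1r poly_actZ scaleN1r. Qed.

Lemma poly_act_sum (I : Type) (r : seq I) (P : pred I) (F : I -> {poly K}) z :
  poly_act T (\sum_(i <- r | P i) F i) z = \sum_(i <- r | P i) poly_act T (F i) z.
Proof.
exact: (big_morph (fun p => poly_act T p z) (fun p q => poly_actD p q z)
  (poly_act0 z)).
Qed.

Lemma poly_act_comm (S : {linear V -> V}) p z :
  (forall y, S (T y) = T (S y)) -> S (poly_act T p z) = poly_act T p (S z).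
Proof.
move=> ST; rewrite /poly_act linear_sum; apply: eq_bigr => i _.
rewrite linearZ /=; congr (_ *: _).
by elim: (nat_of_ord i) => //= n <-; rewrite ST.
Qed.

Lemma poly_actM p q z : poly_act T (p * q) z = poly_act T p (poly_act T q z).
Proof.
elim/poly_ind: p z => [|p c IH] z; first by rewrite mul0r !poly_act0.
rewrite mulrDl mulrAC !poly_actD !poly_actMX IH mul_polyC poly_actZ poly_actC.
by rewrite poly_act_comm.
Qed.

Lemma poly_actXn n z : poly_act T 'X^n z = iter n T z.
Proof.
by elim: n z => [|n IH] z; rewrite ?poly_act1 // exprSr poly_actMX IH iterSr.
Qed.

End PolyAction.

Section CirclePoly.
Variables (K : comNzRingType) (h : K).

(** The polynomial X^n p(h (X + X^-1)), for n at least the degree of p. *)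
Definition circle_poly (p : {poly K}) (n : nat) : {poly K} :=
  \sum_(i < n.+1) p`_i *: ((h *: ('X^2 + 1)) ^+ i * 'X^(n - i)).

Lemma size_circle_poly p n : (size (circle_poly p n) <= (2 * n).+1)%N.
Proof.
apply: leq_trans (size_sum _ _ _) _; apply/bigmax_leqP => i _.
apply: leq_trans (size_scale_leq _ _) _.
apply: leq_trans (size_polyMleq _ _) _; rewrite size_polyXn addnS /=.
have sX : (size (h *: ('X^2 + 1 : {poly K})) <= 3)%N.
  apply: leq_trans (size_scale_leq _ _) _.
  by apply: leq_trans (size_polyD _ _) _; rewrite size_polyXn size_poly1.
have : (size ((h *: ('X^2 + 1)) ^+ i) <= (2 * i).+1)%N.
  apply: leq_trans (size_poly_exp_leq _ _) _.
  by rewrite ltnS leq_mul2r -subn1 leq_subLR sX orbT.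
move=> hs; apply: leq_trans (leq_add hs (leqnn _)) _.
by have := ltn_ord i; lia.
Qed.

(** U T = h (U^2 + 1) amounts to T = h (U + U^-1) for invertible U; so U^n p(T) is a
    polynomial in U. *)
Lemma poly_act_circle (V : lmodType K) (T U : {linear V -> V})
    (p : {poly K}) n z :
  (size p <= n.+1)%N -> (forall y, U (T y) = T (U y)) ->
  (forall y, U (T y) = h *: (U (U y) + y)) ->
  poly_act U (circle_poly p n) z = iter n U (poly_act T p z).
Proof.
move=> pn UT hU.
have UnT m y : iter m U (T y) = T (iter m U y) by elim: m => //= m ->; rewrite UT.
have UTi m i y : iter m U (iter i T y) = iter i T (iter m U y).
  by elim: i => //= i <-; rewrite UnT.
have Uh i y : poly_act U ((h *: ('X^2 + 1)) ^+ i) y = iter i U (iter i T y).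
  elim: i y => [|i IH] y; first by rewrite poly_act1.
  rewrite exprSr poly_actM poly_actZ poly_actD poly_actXn poly_act1 /= -hU IH.
  by rewrite -[U (T y)]/(iter 1 U (T y)) -UTi /= -!iterSr.
rewrite (poly_act_wide _ _ pn) /circle_poly poly_act_sum.
have -> m : iter m U (\sum_(i < n.+1) p`_i *: iter i T z) =
    \sum_(i < n.+1) p`_i *: iter m U (iter i T z).
  elim: m => //= m ->; rewrite linear_sum.
  by apply: eq_bigr => i _; rewrite linearZ.
apply: eq_bigr => i _; rewrite poly_actZ poly_actM poly_actXn Uh.
by rewrite -UTi -iterD subnKC // -ltnS.
Qed.

End CirclePoly.

Section FunctionalCalculus.
Variables (R : realType) (B : cstarAlgType R).
Implicit Types (b w z : B) (p : {poly R}).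

Fact unitary_act_is_linear b w (j : R[i]) : linear (unitary_act b w j).
Proof.
move=> a y z; rewrite /unitary_act !cmulDr !cmulZr [in RHS]scalerDr [in RHS]addrACA.
congr (_ + _); rewrite [in RHS]scalerA (mulrC a) -scalerA -[in RHS]scalerDr.
by congr (_ *: _); rewrite scalerBr opprD addrACA.
Qed.

HB.instance Definition _ b w j :=
  GRing.isLinear.Build R[i] B B *:%R (unitary_act b w j)
    (unitary_act_is_linear b w j).

(** p(b) z; keeping the vector z avoids adjoining a unit for the constant term
    of p. *)
Definition fcalc b p z := poly_act (cmul b) (map_poly (real_complex R) p) z.

Lemma fcalcM b p q z : fcalc b (p * q) z = fcalc b p (fcalc b q z).
Proof. by rewrite /fcalc rmorphM poly_actM. Qed.

Lemma fcalcB b p q z : fcalc b (p - q) z = fcalc b p z - fcalc b q z.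
Proof. by rewrite /fcalc rmorphB poly_actB. Qed.

Lemma fcalcXn b n z : fcalc b 'X^n z = iter n (cmul b) z.
Proof. by rewrite /fcalc map_polyXn poly_actXn. Qed.

(** On the unit circle (u + u^-1) / 2 is the real part of u. *)
Lemma horner_circle_poly p (tau : R) (n : nat) (u : R[i]) :
  (size p <= n.+1)%N -> `|u| = 1 ->
  (circle_poly (tau / 2)%:C (map_poly (real_complex R) p) n).[u] =
    u ^+ n * (p.[tau * complex.Re u])%:C.
Proof.
move=> pn u1.
have u0 : u != 0 by rewrite -normr_gt0 u1.
have uV : u^-1 = conjc u by rewrite invc_norm u1 expr1n invr1 mul1r.
have uu : (tau / 2)%:C * (u ^+ 2 + 1) = u * (tau * complex.Re u)%:C.
  have -> : u ^+ 2 + 1 = u * (u + conjc u) by rewrite mulrDr -uV mulfV // expr2.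
  rewrite addcJ mulrCA; congr (_ * _).
  by rewrite mulrA -(rmorph_nat (real_complex R)) -!rmorphM /= divfK ?pnatr_eq0.
rewrite /circle_poly horner_sum.
rewrite [in RHS](@horner_coef_wide _ n.+1) // rmorph_sum mulr_sumr.
apply: eq_bigr => i _.
rewrite coef_map hornerZ hornerM horner_exp hornerZ hornerD !hornerXn hornerC uu.
rewrite exprMn mulrAC -exprD subnKC -1?ltnS //.
rewrite [in RHS]rmorphM [in RHS]rmorphXn /=.
by rewrite mulrCA.
Qed.

(** u^n p(b) is a polynomial in an isometry u with 2n + 1 coefficients, each of
    modulus at most the supremum of |p| on [-tau, tau]. *)
Lemma nrm_fcalc_crude b p (M tau : R) z : 0 < tau -> star b = b ->
  nrm b <= tau / 2 -> (forall t, `|t| <= tau -> `|p.[t]| <= M) ->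
  forall n, (size p <= n.+1)%N ->
  nrm (fcalc b p z) <= (2 * n%:R + 1) * M * nrm z.
Proof.
move=> tau0 sb b2 pM n pn.
pose c := tau^-1%:C *: b.
have bE : b = tau%:C *: c.
  by rewrite scalerA -rmorphM /= mulfV ?gt_eqF // scale1r.
have sc : star c = c by rewrite starZr sb.
have c2 : nrm c <= 2^-1.
  rewrite nrmZr ger0_norm ?invr_ge0 ?(ltW tau0) // ler_pdivrMl //.
clearbody c.
(* c = b / tau is the real part of the unitary u = c + i (1 - w) *)
have [w [_ sw cw w2]] := half_sqrt_exists (sub_cstarT B) I sc c2.
pose U : {linear B -> B} := unitary_act c w 'i.
have UE y : U y = c *c y + 'i *: (y - w *c y) by [].
have nU y : nrm (U y) = nrm y by rewrite /= nrm_unitary_act ?mul_ii ?conjc_i.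
have nUn m y : nrm (iter m U y) = nrm y by elim: m => //= m <-; rewrite nU.
have iN : - 'i * - 'i = -1 :> R[i] by rewrite mulrNN mul_ii.
have UV y : U (unitary_act c w (- 'i) y) = y.
  by have := unitary_actN cw w2 y iN; rewrite opprK.
have UB y : U (b *c y) = b *c U y.
  rewrite bE !cmulZl linearZ /=; congr (_ *: _); rewrite !UE.
  by rewrite cmulDr cmulZr cmulBr !cmulA cw.
have hU y : U (b *c y) = (tau / 2)%:C *: (U (U y) + y).
  rewrite -{3}[y]UV -linearD -linearZ; congr (U _).
  rewrite UE /unitary_act scaleNr addrACA subrr addr0 -mulr2n -(scaler_nat 2 (c *c y)) scalerA.
  rewrite -(rmorph_nat (real_complex R)) -rmorphM /= divfK ?pnatr_eq0 //.
  by rewrite bE cmulZl.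
set q := map_poly (real_complex R) p.
have qn : (size q <= n.+1)%N by apply: leq_trans (size_poly _ _) _.
have coefs k : normc (circle_poly (tau / 2)%:C q n)`_k <= M.
  rewrite -lecR -norm_normc; apply: norm_coef_le => u u1.
  rewrite horner_circle_poly // normrM normrX u1 expr1n mul1r norm_normc normcR.
  rewrite lecR pM // normrM gtr0_norm // ler_piMr ?(ltW tau0) //.
  by rewrite -lecR (le_trans (normc_ge_Re u)) // u1.
rewrite /fcalc -(nUn n) -(poly_act_circle _ qn UB hU).
rewrite (poly_act_wide _ _ (size_circle_poly _ _ _)).
apply: le_trans (nrm_sum _ _ _) _.
have -> : 2 * n%:R + 1 = (2 * n)%N.+1%:R :> R by rewrite -[RHS]natr1 natrM.
rewrite -mulrA mulr_natl.
have -> : M * nrm z *+ (2 * n).+1 = \sum_(i < (2 * n).+1) M * nrm z.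
  by rewrite sumr_const card_ord.
apply: ler_sum => i _; rewrite nrmZ nUn.
by rewrite ler_wpM2r ?nrm_ge0.
Qed.

Lemma star_fcalc b p y z : star b = b ->
  star (fcalc b p y) *c z = star y *c fcalc b p z.
Proof.
move=> sb; rewrite /fcalc /poly_act raddf_sum cmul_suml cmul_sumr.
apply: eq_bigr => i _; rewrite /= coef_map /= starZr cmulZl cmulZr.
congr (_ *: _); elim: (nat_of_ord i) z => //= n IH z.
by rewrite starM sb -cmulA IH -iterSr.
Qed.

Lemma nrm_fcalc_sqr b p z : star b = b ->
  nrm (fcalc b p z) ^+ 2 <= nrm z * nrm (fcalc b (p ^+ 2) z).
Proof.
move=> sb; rewrite -nrm_star_cmul star_fcalc // -fcalcM -(nrm_star z).
exact: nrmM_le.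
Qed.

(** The constant 2n + 1 of the crude bound grows linearly along the powers
    p^(2^k), while the C*-identity gives |p(b) z|^(2^k) <= |p^(2^k)(b) z| for unit
    vectors z; so in the limit only the supremum remains. *)
Theorem nrm_fcalc_le b p (M tau : R) z : 0 < tau -> star b = b ->
  nrm b <= tau / 2 -> (forall t, `|t| <= tau -> `|p.[t]| <= M) ->
  nrm (fcalc b p z) <= M * nrm z.
Proof.
move=> tau0 sb b2 pM.
have M0 : 0 <= M by apply: le_trans (pM 0 _); rewrite ?normr0 ?normr_ge0 ?ltW.
have [z0|zn0] := eqVneq (nrm z) 0.
  by have := nrm_fcalc_crude z tau0 sb b2 pM (leqnSn _); rewrite z0 !mulr0.
have zp : 0 < nrm z by rewrite lt_neqAle eq_sym zn0 nrm_ge0.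
rewrite -ler_pdivrMr //.
pose g q := nrm (fcalc b q z) / nrm z.
have gX q k : g q ^+ (2 ^ k) <= g (q ^+ (2 ^ k)).
  elim: k q => [|k IH] q; first by rewrite expn0 !expr1.
  rewrite expnS !exprM; apply: le_trans (IH (q ^+ 2)).
  rewrite lerXn2r ?nnegrE ?exprn_ge0 ?divr_ge0 ?nrm_ge0 //.
  rewrite expr_div_n ler_pdivrMr ?exprn_gt0 // [nrm z ^+ 2]expr2 mulrA divfK //.
  by rewrite mulrC nrm_fcalc_sqr.
apply: (@le_of_pow2_le _ _ _ (2 * (size p).-1%:R)) => // k.
apply: le_trans (gX p k) _; rewrite ler_pdivrMr //.
rewrite -mulrA -natrM; apply: (nrm_fcalc_crude z tau0 sb b2).
  by move=> t /pM pt; rewrite horner_exp normrX lerXn2r ?nnegrE ?normr_ge0.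
exact: size_poly_exp_leq.
Qed.

End FunctionalCalculus.

(** * Adding a closed ideal to a closed subalgebra *)

Section BumpPoly.
Variable R : realType.
Implicit Types (y : {poly R}) (t s : R).

(** Visser's iteration q |-> q + (y^2 - q^2) / 2 for the square root of y^2. *)
Fixpoint abs_poly y n : {poly R} :=
  if n is n'.+1 then abs_poly y n' + 2^-1 *: (y ^+ 2 - abs_poly y n' ^+ 2) else 0.

(** With s = |y(t)| <= 1, the error e_n = s - q_n satisfies
    e_(n+1) = e_n (1 - (s + q_n) / 2) <= e_n (1 - s / 2); by induction
    e_n (2 + n s) <= 2 s. *)
Lemma abs_polyP y n t : `|y.[t]| <= 1 ->
  0 <= (abs_poly y n).[t] <= `|y.[t]| /\
  `|y.[t]| - (abs_poly y n).[t] <= 2 / (n.+2)%:R.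
Proof.
move=> y1; set s := `|y.[t]| in y1 *.
have s0 : 0 <= s by rewrite normr_ge0.
have ys : y.[t] ^+ 2 = s ^+ 2 by rewrite -normrX ger0_norm ?sqr_ge0.
have step m : (abs_poly y m.+1).[t] =
    (abs_poly y m).[t] + 2^-1 * (s ^+ 2 - (abs_poly y m).[t] ^+ 2).
  by rewrite /= hornerD hornerZ hornerD hornerN !horner_exp ys.
have H m : [/\ 0 <= (abs_poly y m).[t], (abs_poly y m).[t] <= s &
    (s - (abs_poly y m).[t]) * (2 + m%:R * s) <= 2 * s].
  elim: m => [|m [h0 hs IH]]; first by rewrite /= horner0; split=> //; lra.
  rewrite step -natr1; have m0 : 0 <= m%:R :> R by [].
  move: IH h0 hs m0; set q := (abs_poly y m).[t]; set k := m%:R => IH h0 hs k0.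
  have ks : 0 <= k * s by rewrite mulr_ge0.
  have sq : 0 <= (s - q) * (s + q) by rewrite mulr_ge0 //; lra.
  have e : s - (q + 2^-1 * (s ^+ 2 - q ^+ 2)) = (s - q) * (1 - (s + q) / 2) by field.
  have e0 : 0 <= (s - q) * (1 - (s + q) / 2) by rewrite mulr_ge0 //; lra.
  split; [ | by rewrite -subr_ge0 e | rewrite e].
    by rewrite subr_sqr addr_ge0 // mulr_ge0 // invr_ge0.
  apply: le_trans IH; rewrite -mulrA ler_wpM2l ?subr_ge0 //.
  nra.
have [h0 hs h2] := H n; split; first by rewrite h0.
rewrite -(addn2 n) natrD ler_pdivlMr ?ltr_wpDl // addrC.
move: h2 h0 hs; have : 0 <= n%:R :> R by [].
set q := (abs_poly y n).[t]; set k := n%:R => k0 h2 h0 hs.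
have [->|sn0] := eqVneq s 0; first by nra.
have sp : 0 < s by rewrite lt_neqAle eq_sym sn0.
rewrite -(ler_pM2l sp); apply: le_trans (_ : (s - q) * (2 + k * s) <= _); nra.
Qed.

(** Polynomials approximating max(0, t^2 - r^2) on [-1, 1]: take (y + |y|) / 2 for
    y = t^2 - r^2, with |y| replaced by [abs_poly].  A function that vanishes near 0
    but not identically is what tells a small element from a large one. *)
Lemma bump_poly_exists (r : R) : 0 <= r <= 1 ->
  exists g : nat -> {poly R}, [/\
    forall n t, `|t| <= r -> `|(g n).[t]| <= n.+1%:R^-1,
    forall n t, `|t| <= 1 -> `|('X^2 - g n).[t]| <= r ^+ 2 + n.+1%:R^-1 &
    forall m n t, `|t| <= 1 -> `|(g m - g n).[t]| <= m.+1%:R^-1 + n.+1%:R^-1].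
Proof.
move=> /andP[r0 r1]; pose y : {poly R} := 'X^2 - (r ^+ 2)%:P.
have yE t : y.[t] = t ^+ 2 - r ^+ 2 by rewrite hornerD hornerN hornerXn hornerC.
clearbody y; pose g n : {poly R} := 2^-1 *: (y + abs_poly y n).
have sqr_le t (s : R) : `|t| <= s -> t ^+ 2 <= s ^+ 2.
  by move=> ts; rewrite -real_normK ?num_real // lerXn2r ?nnegrE ?(le_trans _ ts).
have y1 t : `|t| <= 1 -> `|y.[t]| <= 1.
  move=> /sqr_le; rewrite yE ler_norml expr1n => t1.
  have := sqr_ge0 t; have := sqr_le r 1; rewrite ger0_norm // => /(_ r1).
  by have := sqr_ge0 r; lra.
have gE n t : `|t| <= 1 -> exists e, [/\ 0 <= e, e <= n.+1%:R^-1 &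
    (g n).[t] = (y.[t] + `|y.[t]|) / 2 - e].
  move=> /y1 /(abs_polyP n) [/andP[_ h1] h2].
  exists ((`|y.[t]| - (abs_poly y n).[t]) / 2).
  rewrite hornerZ hornerD; split; [lra| |by field].
  have : (n.+2)%:R^-1 <= n.+1%:R^-1 :> R by rewrite lef_pV2 ?posrE ?ltr0n // ler_nat.
  move: h2; set a := n.+2%:R^-1; set b := n.+1%:R^-1; set s := `|_|.
  by set q := _.[t] => *; lra.
exists g; split=> [n t tr|n t t1|m n t t1].
- have [e [e0 en ->]] := gE n t (le_trans tr r1).
  have : y.[t] <= 0 by rewrite yE subr_le0 sqr_le.
  by move=> /ler0_norm ->; rewrite subrr mul0r sub0r normrN ger0_norm.
- have [e [e0 en ge]] := gE n t t1; rewrite hornerD hornerN hornerXn {}ge.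
  have ty : t ^+ 2 = y.[t] + r ^+ 2 by rewrite yE subrK.
  rewrite ty; have := sqr_ge0 t; rewrite ty => t0; have r20 := sqr_ge0 r.
  move: en t0 r20; set a := n.+1%:R^-1; set q := r ^+ 2.
  by have [y0|y0] := ger0P y.[t] => *; rewrite ler_norml; apply/andP; split; lra.
- have [e [e0 em ge]] := gE m t t1; have [f [f0 fn gf]] := gE n t t1.
  rewrite hornerD hornerN ge gf ler_norml; move: em fn.
  by set a := m.+1%:R^-1; set b := n.+1%:R^-1 => *; apply/andP; split; lra.
Qed.

End BumpPoly.

Section Ideal.
Variables (R : realType) (A : cstarAlgType R) (S J : set A).
Hypotheses (SS : sub_cstar S) (SJ : sub_cstar J).
Hypothesis SIJ : forall x, S x -> J x -> x = 0.
Hypothesis Jl : forall x y, S x -> J y -> J (x *c y).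
Hypothesis Jr : forall x y, J x -> S y -> J (x *c y).

Lemma sub_cstarB (T : set A) x y : sub_cstar T -> T x -> T y -> T (x - y).
Proof. by case=> [[_ TD TZ _ _] _] Tx Ty; rewrite -scaleN1r; apply/TD/TZ. Qed.

(** Modulo the ideal J, a and a + d coincide, hence so do their polynomials. *)
Lemma fcalc_mod_ideal (a d : A) (p : {poly R}) : S a -> J d ->
  S (fcalc a p a) /\ J (fcalc a p a - fcalc (a + d) p (a + d)).
Proof.
move=> Sa Jd; set x := a + d.
have [[S0 SD SZ SM _] _] := SS; have [[J0 JD JZ JM _] _] := SJ.
have it n : S (iter n (cmul a) a) /\ J (iter n (cmul a) a - iter n (cmul x) x).
  elim: n => [|n [Su Juv]] /=.
    by split=> //; rewrite /x opprD addrA subrr add0r -scaleN1r; apply: JZ.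
  split; first exact: SM.
  set u := iter n _ a in Su Juv *; set v := iter n _ x in Juv *.
  have -> : a *c u - x *c v = a *c (u - v) - (d *c u - d *c (u - v)).
    by rewrite -(cmulBr u (u - v) d) subKr /x cmulDl opprD addrA cmulBr.
  apply: (sub_cstarB SJ); first exact: Jl.
  by apply: (sub_cstarB SJ); [apply: Jr | apply: JM].
rewrite /fcalc /poly_act -sumrB; split.
  by apply: (big_ind S) => // i _; apply/SZ; case: (it i).
by apply: (big_ind J) => // i _; rewrite -scalerBr; apply/JZ; case: (it i).
Qed.

(** With r = 2 |x|, the estimate on [-r, r] makes k_n = g_n(x) x tend to 0, so
    h_n = g_n(a) a and h_n - k_n have the same limit; it lies in S and in J, hence is 0.
    On the other hand h_n stays within about r^2 |a| of a^3. *)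
Lemma nrm_le_add_ideal_small a d : S a -> J d -> star a = a -> star d = d ->
  nrm a <= 2^-1 -> nrm a <= 2 * nrm (a + d).
Proof.
move=> Sa Jd sa sd a2; set x := a + d.
have sx : star x = x by rewrite starD sa sd.
have [|r1] := leP 1 (2 * nrm x); first by move: a2; lra.
have [x0|xn0] := eqVneq x 0.
  rewrite x0 nrm0 mulr0 (SIJ Sa) ?nrm0 //.
  have -> : a = 0 - d by rewrite -x0 /x addrK.
  by apply: (sub_cstarB SJ) => //; case: SJ => [[]].
set r := 2 * nrm x in r1 *.
have r0 : 0 < r.
  by rewrite mulr_gt0 // lt_neqAle nrm_ge0 andbT eq_sym; apply: contra_neq xn0 => /nrm_eq0.
have [|g [g_r g_sq g_cauchy]] := @bump_poly_exists R r; first by rewrite !ltW.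
have xr : nrm x <= r / 2 by rewrite /r mulrAC divff ?mul1r.
pose h n := fcalc a (g n) a; pose k n := fcalc x (g n) x.
have a1 : nrm a <= 1 / 2 by rewrite mul1r.
have hk n : S (h n) /\ J (h n - k n) by apply: fcalc_mod_ideal.
have h_cvg : cvgn h.
  apply: cauchy_nrm_cvg => e e0; have [N hN] := invSn_lt e0.
  exists N => m n /hN em /hN en; rewrite -fcalcB.
  have := nrm_fcalc_le a ltr01 sa a1 (g_cauchy m n).
  move=> /le_lt_trans; apply.
  apply: le_lt_trans (_ : (m.+1%:R^-1 + n.+1%:R^-1) * (1 / 2) < e).
    by rewrite ler_wpM2l // addr_ge0 ?invr_ge0.
  by move: em en; set p := m.+1%:R^-1; set q := n.+1%:R^-1; lra.
have k_cvg : k @ \oo --> 0.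
  apply/cvg_nrmP => e e0; have [N hN] := invSn_lt e0.
  exists N => // n /hN en; rewrite subr0.
  have := nrm_fcalc_le x r0 sx xr (g_r n); rewrite -/(k n).
  move=> /le_lt_trans; apply; apply: le_lt_trans en.
  by rewrite ler_piMr ?invr_ge0 //; move: r1; rewrite /r; have := nrm_ge0 x; lra.
have /cvg_ex[l hl] := h_cvg.
have l0 : l = 0.
  apply: SIJ; first by apply: sub_cstar_cvg SS _ hl => n; case: (hk n).
  apply: sub_cstar_cvg SJ (fun n => (hk n).2) _.
  by rewrite -[l]subr0; apply: cvgB.
have a3 : nrm (a *c (a *c a)) <= r ^+ 2 * nrm a.
  apply/ler_addgt0Pr => e e0.
  have /cvg_nrmP/(_ (e / 2)) := hl; rewrite l0 => /(_ _)[|N _ hN].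
    by rewrite divr_gt0.
  have [M hM] := invSn_lt (divr_gt0 e0 (ltr0Sn R 1)).
  set n := maxn N M; have := hN n; rewrite /= leq_maxl subr0 => /(_ isT) hn.
  have nM := hM n (leq_maxr _ _).
  have := nrm_fcalc_le a ltr01 sa a1 (g_sq n).
  rewrite fcalcB fcalcXn /= -/(h n) => hd.
  have := nrmD (a *c (a *c a) - h n) (h n); rewrite subrK.
  have : n.+1%:R^-1 * nrm a <= n.+1%:R^-1 by rewrite ler_piMr ?invr_ge0 //; lra.
  move: hn nM hd; rewrite mulrDl; set q := n.+1%:R^-1.
  set qa := q * _; set ra := r ^+ 2 * _; set b := nrm (_ - _); set c := nrm (h n).
  by lra.
(* the C*-identity gives |a|^4 = |a^4| <= |a| |a^3| *)
have a4 : nrm a ^+ 4 <= nrm a * (r ^+ 2 * nrm a).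
  have -> : nrm a ^+ 4 = nrm (a *c (a *c (a *c a))).
    by rewrite cmulA nrm_sqr ?starM ?sa // nrm_sqr // -exprM.
  by apply: le_trans (nrmM_le _ _) _; rewrite ler_wpM2l ?nrm_ge0.
have [->|an0] := eqVneq (nrm a) 0; first exact: ltW.
have ap : 0 < nrm a by rewrite lt_neqAle eq_sym an0 nrm_ge0.
rewrite leNgt; apply/negP => ra.
have : r ^+ 2 < nrm a ^+ 2 by rewrite ltrXn2r ?nnegrE ?ltW.
move: a4 ap; set p := nrm a; set q := r ^+ 2.
have -> : p ^+ 4 = p ^+ 2 * p ^+ 2 by rewrite -exprD.
have -> : p * (q * p) = q * p ^+ 2 by rewrite mulrCA -expr2.
by move=> h4 p0 qp; have := exprn_gt0 2 p0; nra.
Qed.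

(** Apply the self-adjoint case, scaled into the ball of radius 1/2, to
    (a + d)^* (a + d), which is a^* a plus an element of J. *)
Lemma nrm_le_add_ideal a d : S a -> J d -> nrm a <= 2 * nrm (a + d).
Proof.
have [[S0 SD SZ SM Ss] _] := SS; have [[J0 JD JZ JM Js] _] := SJ.
have sa_le b c : S b -> J c -> star b = b -> star c = c -> nrm b <= 2 * nrm (b + c).
  move=> Sb Jc sb sc; have [->|bn0] := eqVneq (nrm b) 0.
    by rewrite mulr_ge0 ?nrm_ge0.
  have bp : 0 < nrm b by rewrite lt_neqAle eq_sym bn0 nrm_ge0.
  pose e := (2 * nrm b)^-1; have e0 : 0 < e by rewrite invr_gt0 mulr_gt0.
  have eb : e * nrm b = 2^-1 by rewrite /e invfM mulfVK.
  have := @nrm_le_add_ideal_small (e%:C *: b) (e%:C *: c) (SZ _ _ Sb) (JZ _ _ Jc).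
  rewrite !starZr sb sc -scalerDr !nrmZr gtr0_norm // eb => /(_ erefl erefl (lexx _)).
  by rewrite -eb mulrCA ler_pM2l.
move=> Sa Jd; set x := a + d.
have xx : star x *c x = star a *c a + (star d *c a + (star a *c d + star d *c d)).
  by rewrite /x starD cmulDl !cmulDr -!addrA; congr (_ + _); rewrite addrCA.
have := sa_le (star a *c a) _ (SM _ _ (Ss _ Sa) Sa)
  (JD _ _ (Jr (Js _ Jd) Sa) (JD _ _ (Jl (Ss _ Sa) Jd) (JM _ _ (Js _ Jd) Jd))).
rewrite -xx !nrm_star_cmul !starD !starM !starK => /(_ erefl).
rewrite addrCA => /(_ erefl).
have := nrm_ge0 a; have := nrm_ge0 x; nra.
Qed.

End Ideal.

(** * Finite sums of components *)

Section MeetClosed.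
Variables (d : Order.disp_t) (L : meetSemilatticeType d).
Implicit Types (F : seq L) (i j m : L).

Definition meet_stable F := forall i j, i \in F -> j \in F -> (i `&` j)%O \in F.

Fixpoint meet_closure F : seq L :=
  if F is i :: F' then
    i :: meet_closure F' ++ [seq (i `&` j)%O | j <- meet_closure F']
  else [::].

Lemma meet_closureP F : meet_stable (meet_closure F).
Proof.
elim: F => [//|i F IH] j k /=; set G := meet_closure F in IH *.
have cases x : x \in i :: G ++ [seq (i `&` y)%O | y <- G] ->
    [\/ x = i, x \in G | exists2 y, y \in G & x = (i `&` y)%O].
  rewrite inE mem_cat => /or3P[/eqP|xG|/mapP]; first by constructor 1.
    by constructor 2.
  by constructor 3.
have inG y : y \in G -> y \in i :: G ++ [seq (i `&` y)%O | y <- G].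
  by move=> yG; rewrite inE mem_cat yG orbT.
have iG y : y \in G -> (i `&` y)%O \in i :: G ++ [seq (i `&` y)%O | y <- G].
  by move=> yG; rewrite inE mem_cat map_f ?orbT.
move=> /cases[->|jG|[x xG ->]] /cases[->|kG|[y yG ->]].
- by rewrite meetxx mem_head.
- exact: iG.
- by rewrite meetA meetxx iG.
- by rewrite meetC iG.
- by rewrite inG // IH.
- by rewrite meetCA iG // IH.
- by rewrite meetC meetA meetxx iG.
- by rewrite -meetA iG // IH.
- by rewrite meetACA meetxx iG // IH.
Qed.

Lemma sub_meet_closure F : {subset F <= meet_closure F}.
Proof.
elim: F => // i F IH j /=; rewrite !inE mem_cat => /orP[->//|/IH ->].
by rewrite orbT.
Qed.

(** The inductive step on finite sets of indices removes such an m: what remains is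
    stable under meets and absorbs meets with m. *)
Lemma max_exists i F : exists2 m, m \in i :: F &
  forall j, j \in i :: F -> (m <= j)%O -> j = m.
Proof.
elim: F i => [|k F IH] i.
  by exists i; rewrite ?mem_head // => j; rewrite inE => /eqP.
have [m mF mmax] := IH k.
have [mi|mi] := boolP (m < i)%O.
  exists i; rewrite ?mem_head // => j; rewrite inE => /orP[/eqP//|jF ij].
  have jm : j = m by apply: mmax => //; apply: le_trans ij; exact: ltW.
  by move: (lt_le_trans mi ij); rewrite jm ltxx.
exists m; first by rewrite inE mF orbT.
move=> j; rewrite inE => /orP[/eqP ->|jF]; last exact: mmax.
by rewrite le_eqVlt (negPf mi) orbF => /eqP.
Qed.

End MeetClosed.

Section Graded.
Variables (R : realType) (d : Order.disp_t) (L : meetSemilatticeType d).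
Variables (AA : cstarAlgType R) (A : L -> set AA).
Hypothesis hA : graded A.
Implicit Types (F : seq L) (i j m : L) (x y : AA) (S T : L -> AA).

Lemma graded_sub_cstar i : sub_cstar (A i). Proof. by case: hA. Qed.

Lemma graded0 i : A i 0.
Proof. by have [[]] := graded_sub_cstar i. Qed.

Lemma gradedD i x y : A i x -> A i y -> A i (x + y).
Proof. by have [[_ + _ _ _] _] := graded_sub_cstar i; apply. Qed.

Lemma gradedZ i (a : R[i]) x : A i x -> A i (a *: x).
Proof. by have [[_ _ + _ _] _] := graded_sub_cstar i; apply. Qed.

Lemma graded_star i x : A i x -> A i (star x).
Proof. by have [[_ _ _ _ +] _] := graded_sub_cstar i; apply. Qed.

Lemma gradedM i j x y : A i x -> A j y -> A (i `&` j)%O (x *c y).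
Proof. by case: hA => _ _ _; apply. Qed.

#[local] Hint Resolve graded0 : core.

(** Families are total functions on L; a sum over F reads only the values on F. *)
Definition component_family S := forall i, A i (S i).

Definition graded_sum F : set AA :=
  [set x | exists2 S, component_family S & x = \sum_(i <- F) S i].

Lemma graded_sum0_eq0 F S : uniq F -> component_family S ->
  \sum_(i <- F) S i = 0 -> forall i, i \in F -> S i = 0.
Proof.
move=> uF AS S0 i iF; have [_ + _ _] := hA.
pose T j := if j \in F then S j else 0.
have T0 j : j \notin F -> T j = 0 by rewrite /T => /negPf ->.
move=> /(_ T); have -> : S i = T i by rewrite /T iF.
apply.
- by move=> j; rewrite /T; case: ifP.
- apply: sub_finite_set (finite_seq F) => j /=.
  by apply: contraNT => /T0 ->.
- rewrite -(fsbig_widen [set` F]) //.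
    rewrite -fsbig_seq // -[RHS]S0; apply: eq_big_seq => j jF.
    by rewrite /T jF.
  by move=> j [_ /= jF]; apply: T0; apply/negP.
Qed.

Lemma graded_sum_comp F i x : uniq F -> i \in F -> A i x -> graded_sum F x.
Proof.
move=> uF iF Ax; exists (fun j => if j == i then x else 0).
  by move=> j; case: eqP => [->|].
by rewrite -big_mkcond -big_filter filter_pred1_uniq // big_seq1.
Qed.

Lemma graded_sumD F x y : graded_sum F x -> graded_sum F y -> graded_sum F (x + y).
Proof.
move=> [S AS ->] [T AT ->]; exists (fun i => S i + T i); last by rewrite big_split.
by move=> i; apply: gradedD.
Qed.

Lemma graded_sumM F x y : uniq F -> meet_stable F ->
  graded_sum F x -> graded_sum F y -> graded_sum F (x *c y).
Proof.
move=> uF mF [S AS ->] [T AT ->].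
rewrite cmul_suml big_seq; apply: (big_ind (graded_sum F)).
- by exists (fun=> 0); rewrite ?big1.
- exact: graded_sumD.
move=> i iF; rewrite cmul_sumr big_seq; apply: (big_ind (graded_sum F)).
- by exists (fun=> 0); rewrite ?big1.
- exact: graded_sumD.
move=> j jF; apply: (graded_sum_comp (i := (i `&` j)%O)) => //; first exact: mF.
exact: gradedM.
Qed.

(** The bound on components makes each component of a convergent sequence of the
    sum a Cauchy sequence, whose limit stays in the closed set A i. *)
Lemma graded_sum_sub_cstar F (C : R) : uniq F -> meet_stable F -> 0 <= C ->
  (forall S, component_family S ->
     forall i, i \in F -> nrm (S i) <= C * nrm (\sum_(j <- F) S j)) ->
  sub_cstar (graded_sum F).
Proof.
move=> uF mF C0 hC; split; first split.
- by exists (fun=> 0); rewrite ?big1.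
- exact: graded_sumD.
- move=> a x [S AS ->]; exists (fun i => a *: S i); last by rewrite scaler_sumr.
  by move=> i; apply: gradedZ.
- by move=> x y; apply: graded_sumM.
- move=> x [S AS ->]; exists (fun i => star (S i)); last by rewrite raddf_sum.
  by move=> i; apply: graded_star.
apply: nrm_closed => x xF.
have pos n : 0 < n.+1%:R^-1 :> R by rewrite invr_gt0.
have /choice[S hS] : forall n, exists S, component_family S /\
    nrm (x - \sum_(i <- F) S i) < n.+1%:R^-1.
  by move=> n; have [_ [S AS ->] hx] := xF _ (pos n); exists S.
have Sx : (fun n => \sum_(i <- F) S n i) @ \oo --> x.
  apply/cvg_nrmP => e /invSn_lt[N hN]; exists N => // n /hN nN.
  by rewrite nrm_distC; apply: lt_trans nN; case: (hS n).
have S_cvg i : i \in F -> cvgn (fun n => S n i).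
  move=> iF; apply: cauchy_nrm_cvg => e e0.
  have [|N hN] := @invSn_lt _ (e / (2 * (C + 1))).
    by rewrite divr_gt0 // mulr_gt0 // ltr_wpDl.
  exists N => m n /hN mN /hN nN.
  have := hC (fun i => S m i - S n i) _ i iF.
  move=> /(_ _)/le_lt_trans; apply.
    by move=> j; apply: (sub_cstarB (graded_sub_cstar j)); [case: (hS m)|case: (hS n)].
  rewrite sumrB; set u := \sum_(j <- F) _; set v := \sum_(j <- F) _.
  have hu : nrm (u - x) < m.+1%:R^-1 by rewrite nrm_distC; case: (hS m).
  have hv : nrm (x - v) < n.+1%:R^-1 by case: (hS n).
  have huv : nrm (u - v) < e / (C + 1).
    rewrite -(subrK x u) -addrA; apply: le_lt_trans (nrmD _ _) _.
    have half : e / (2 * (C + 1)) + e / (2 * (C + 1)) = e / (C + 1).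
      by field; rewrite gt_eqF // ltr_wpDl.
    rewrite -half; apply: ltrD; first exact: lt_trans hu mN.
    exact: lt_trans hv nN.
  have : nrm (u - v) * (C + 1) < e by rewrite -ltr_pdivlMr // ltr_wpDl.
  by have := nrm_ge0 (u - v); lra.
pose T i := if i \in F then limn (fun n => S n i) else 0.
exists T.
  move=> i; rewrite /T; case: ifPn => // /S_cvg h.
  by apply: sub_cstar_cvg (graded_sub_cstar i) _ h => n; case: (hS n).
apply: (seq_cvg_unique Sx).
apply: cvg_sum_seq => i iF; rewrite /T iF; exact: S_cvg.
Qed.

(** Induction on the size of F.  For m maximal in F the components other than m
    span a closed ideal, so the m-th component of x has norm at most 2 |x|, the rest
    of x at most 3 |x|, and the inductive bound applies to the rest. *)
Lemma component_nrm_le F : uniq F -> meet_stable F ->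
  exists2 C : R, 0 <= C & forall S, component_family S ->
    forall i, i \in F -> nrm (S i) <= C * nrm (\sum_(j <- F) S j).
Proof.
have [n] := ubnP (size F); elim: n F => // n IH [|k F0]; first by exists 0.
set F := k :: F0 => sF uF mF; have [m mF' mmax] := max_exists k F0.
pose G := rem m F; have FG : perm_eq F (m :: G) by apply: perm_to_rem.
have uG : uniq G by rewrite rem_uniq.
have GE i : (i \in G) = (i != m) && (i \in F) by rewrite mem_rem_uniq // inE.
have mi_G i : i \in G -> (m `&` i)%O \in G.
  rewrite !GE => /andP[im iF]; rewrite mF // andbT.
  by apply: contra im => /eqP/meet_idPl mi; rewrite (mmax i).
have mG : meet_stable G.
  move=> i j iG; have:= iG; rewrite !GE => /andP[im iF] /andP[jm jF].
  rewrite mF // andbT; apply: contra im => /eqP ij.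
  by rewrite (mmax i) // -ij leIl.
have [|C C0 hC] := IH G _ uG mG.
  by move: sF; rewrite (perm_size FG) /= ltnS.
have Gsub : sub_cstar (graded_sum G) := graded_sum_sub_cstar uG mG C0 hC.
have le_top S : component_family S ->
    nrm (S m) <= 2 * nrm (S m + \sum_(j <- G) S j).
  move=> AS; apply: (nrm_le_add_ideal (graded_sub_cstar m) Gsub) => //.
  - move=> x Ax [T AT xT].
    pose T' j := if j == m then - x else T j.
    have : \sum_(j <- m :: G) T' j = 0.
      rewrite big_cons {1}/T' eqxx xT addrC; apply/eqP; rewrite subr_eq0; apply/eqP.
      apply: eq_big_seq => j; rewrite GE /T' => /andP[/negPf -> //].
    move=> /(graded_sum0_eq0 _ _)/(_ m); rewrite mem_head /T' eqxx => h.
    apply/eqP; rewrite -oppr_eq0; apply/eqP/h => //.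
      by rewrite -(perm_uniq FG).
    move=> j; rewrite /T'; case: eqP => [->|//].
    by rewrite -scaleN1r; apply: gradedZ.
  - move=> x y Ax [T AT ->]; rewrite cmul_sumr big_seq.
    apply: (big_ind (graded_sum G)); [by case: Gsub => [[]]|exact: graded_sumD|].
    move=> i /mi_G iG; apply: (graded_sum_comp uG iG); exact: gradedM.
  - move=> x y [T AT ->] Ay; rewrite cmul_suml big_seq.
    apply: (big_ind (graded_sum G)); [by case: Gsub => [[]]|exact: graded_sumD|].
    move=> i /mi_G iG; apply: (graded_sum_comp uG iG); rewrite meetC; exact: gradedM.
  - by exists S.
exists (2 + 3 * C); first by lra.
move=> S AS i; rewrite (perm_mem FG) (perm_big _ FG) /= big_cons inE.
have hm := le_top S AS; set N := nrm (S m + _) in hm *.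
have N0 : 0 <= N by apply: nrm_ge0.
have CN : 0 <= C * N by rewrite mulr_ge0.
move=> /orP[/eqP ->|iG]; first by lra.
apply: le_trans (hC S AS i iG) _.
have : nrm (\sum_(j <- G) S j) <= 3 * N.
  have -> : \sum_(j <- G) S j = S m + \sum_(j <- G) S j - S m by rewrite addrC addKr.
  by apply: le_trans (nrmB _ _) _; rewrite -/N; lra.
move=> /(ler_wpM2l C0); lra.
Qed.

End Graded.

(** * Extension by density *)

Section Extension.
Variables (R : realType) (AA B : cstarAlgType R).

(** The extension is the limit of f along any sequence of D converging to x; the
    Lipschitz bound makes the limit exist and independent of the sequence, so each
    algebraic identity passes to the limit. *)
Lemma star_hom_extension (D : set AA) (f : AA -> B) (C : R) :
  (forall x y, D x -> D y -> D (x + y)) ->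
  (forall (a : R[i]) x, D x -> D (a *: x)) ->
  (forall x y, D x -> D y -> D (x *c y)) ->
  (forall x, D x -> D (star x)) -> dense D ->
  star_hom_on D f -> 0 <= C -> (forall x, D x -> nrm (f x) <= C * nrm x) ->
  exists2 g : AA -> B, star_hom g & forall x, D x -> g x = f x.
Proof.
move=> DD DZ DM Ds dD [fD fZ fM fs] C0 fC.
have DB x y : D x -> D y -> D (x - y).
  by move=> Dx Dy; rewrite -scaleN1r; apply/DD/DZ.
have fB x y : D x -> D y -> f (x - y) = f x - f y.
  by move=> Dx Dy; rewrite -[- y]scaleN1r fD ?fZ //; [rewrite scaleN1r | exact: DZ].
have lip x y : D x -> D y -> nrm (f x - f y) <= C * nrm (x - y).
  by move=> Dx Dy; rewrite -fB // fC //; apply: DB.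
have C1 : 0 < C + 1 by rewrite ltr_wpDl.
have approx (x : AA) : exists u : nat -> AA, (forall n, D (u n)) /\ u @ \oo --> x.
  have pos n : 0 < n.+1%:R^-1 :> R by rewrite invr_gt0.
  have /choice[u hu] : forall n, exists y, D y /\ nrm (x - y) < n.+1%:R^-1.
    by move=> n; have [y Dy hy] := dense_nrmP dD x (pos n); exists y.
  exists u; split=> [n|]; first by case: (hu n).
  apply/cvg_nrmP => e e0.
  have [N hN] := invSn_lt e0; exists N => // n /hN nN; rewrite nrm_distC.
  by apply: lt_trans nN; case: (hu n).
have f_cvg u (x : AA) : (forall n, D (u n)) -> u @ \oo --> x -> cvgn (f \o u).
  move=> Du /cvg_nrmP ux; apply: cauchy_nrm_cvg => e e0.
  have [|N _ hN] := ux (e / (2 * (C + 1))).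
    by rewrite divr_gt0 // mulr_gt0.
  exists N => m n Nm Nn; apply: le_lt_trans (lip _ _ (Du m) (Du n)) _.
  have : nrm (u m - u n) <= e / (C + 1).
    have -> : e / (C + 1) = e / (2 * (C + 1)) + e / (2 * (C + 1)).
      by field; rewrite gt_eqF.
    rewrite -(subrK x (u m)) -addrA; apply: le_trans (nrmD _ _) _.
    apply: lerD; apply: ltW; first exact: hN.
    by rewrite nrm_distC; exact: hN.
  move=> /(ler_wpM2l C0)/le_lt_trans; apply.
  by rewrite mulrCA -[ltRHS]mulr1 ltr_pM2l // ltr_pdivrMr // mul1r ltrDl.
have /choice[U hU] := approx.
pose g (x : AA) : B := limn (f \o U x).
have gP u (x : AA) : (forall n, D (u n)) -> u @ \oo --> x -> (f \o u) @ \oo --> g x.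
  move=> Du ux; have [DU Ux] := hU x.
  rewrite -[f \o u](subrK (f \o U x)) -[g x]add0r.
  apply: cvgD; last exact: f_cvg DU Ux.
  apply/cvg_nrmP => e e0.
  have /cvg_nrmP/(_ (e / (C + 1))) : (fun n => u n - U x n) @ \oo --> x - x.
    exact: cvgB.
  rewrite subrr divr_gt0 // => /(_ isT); apply: filterS => n.
  rewrite !subr0 ltr_pdivlMr // => h.
  apply: le_lt_trans (lip _ _ (Du n) (DU n)) _; apply: le_lt_trans h.
  by rewrite mulrDr mulr1 mulrC lerDl nrm_ge0.
exists g; last first.
  move=> x Dx; apply: (seq_cvg_unique (u := fun=> f x)); last exact: cvg_cst.
  exact: (gP (fun=> x) x (fun=> Dx) (cvg_cst _)).
split=> [x y _ _|a x _|x y _ _|x _].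
- have [DUx Ux] := hU x; have [DUy Uy] := hU y.
  apply: (seq_cvg_unique (gP _ _ (fun n => DD _ _ (DUx n) (DUy n)) (cvgD Ux Uy))).
  rewrite (_ : _ \o _ = (f \o U x) \+ (f \o U y)); first by apply: cvgD; exact: gP.
  by apply/funext => n /=; rewrite fD.
- have [DUx Ux] := hU x.
  have aU : (fun n => a *: U x n) @ \oo --> a *: x by apply: cvgZ => //; exact: cvg_cst.
  apply: (seq_cvg_unique (gP _ _ (fun n => DZ a _ (DUx n)) aU)).
  rewrite (_ : _ \o _ = (fun n => a *: (f \o U x) n)); last first.
    by apply/funext => n /=; rewrite fZ.
  by apply: cvgZ; [exact: cvg_cst | exact: gP].
- have [DUx Ux] := hU x; have [DUy Uy] := hU y.
  apply: (seq_cvg_unique (gP _ _ (fun n => DM _ _ (DUx n) (DUy n)) (cvg_cmul Ux Uy))).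
  rewrite (_ : _ \o _ = (fun n => (f \o U x) n *c (f \o U y) n)).
    by apply: cvg_cmul; exact: gP.
  by apply/funext => n /=; rewrite fM.
- have [DUx Ux] := hU x.
  apply: (seq_cvg_unique (gP _ _ (fun n => Ds _ (DUx n)) (cvg_star Ux))).
  rewrite (_ : _ \o _ = (fun n => star ((f \o U x) n))).
    by apply: cvg_star; exact: gP.
  by apply/funext => n /=; rewrite fs.
Qed.

Lemma star_hom_eq_dense (D : set AA) (f g : AA -> B) : dense D ->
  star_hom f -> star_hom g -> (forall x, D x -> f x = g x) -> f = g.
Proof.
move=> dD hf hg fg; apply/funext => x; apply/eqP; rewrite -subr_eq0; apply/eqP.
have bf y : nrm (f y) <= 2 * nrm y by exact: star_hom_on_nrm_le (sub_cstarT AA) hf y I.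
have bg y : nrm (g y) <= 2 * nrm y by exact: star_hom_on_nrm_le (sub_cstarT AA) hg y I.
have [fD fZ _ _] := hf; have [gD gZ _ _] := hg.
apply: nrm_eq0; apply/le_anti; rewrite nrm_ge0 andbT; apply/ler_addgt0Pr => e e0.
have [|y Dy hy] := dense_nrmP dD x (e := e / 4); first by rewrite divr_gt0.
have -> : f x - g x = f (x - y) - g (x - y).
  rewrite -[- y]scaleN1r fD // gD // fZ // gZ // (fg y) //.
  by rewrite opprD addrACA subrr addr0.
by have := nrmB (f (x - y)) (g (x - y)); have := bf (x - y); have := bg (x - y); lra.
Qed.

End Extension.

(** * The homomorphism of the graded algebra *)

Section GradedHom.
Variables (R : realType) (d : Order.disp_t) (L : meetSemilatticeType d).
Variables (AA B : cstarAlgType R) (A : L -> set AA) (psi_ : L -> AA -> B).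
Hypothesis hA : graded A.
Hypothesis hpsi : forall i : L, star_hom_on (A i) (psi_ i).
Hypothesis hmul : forall (j k : L) (x y : AA), A j x -> A k y ->
  psi_ (j `&` k)%O (x *c y) = psi_ j x *c psi_ k y.
Implicit Types (s : seq (L * AA)) (x : AA) (y : B).

Let A0 := graded0 hA.
Let AD := gradedD hA.
Let AZ := gradedZ hA.
Let As := graded_star hA.
Let AM := gradedM hA.

Let psi0 i : psi_ i 0 = 0.
Proof.
by have [_ pZ _ _] := hpsi i; rewrite -(scale0r (0 : AA)) pZ // scale0r.
Qed.

(** The graph of the map to be extended, given by lists of homogeneous elements,
    possibly with repeated degrees: sums and products of such lists need no
    bookkeeping.  That it is the graph of a function is [graph_fun]. *)
Inductive graph : AA -> B -> Prop :=
  Graph s of (forall p, p \in s -> A p.1 p.2) :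
    graph (\sum_(p <- s) p.2) (\sum_(p <- s) psi_ p.1 p.2).

Lemma graph_comp i x : A i x -> graph x (psi_ i x).
Proof.
move=> Ax; have := @Graph [:: (i, x)]; rewrite !big_seq1 /=; apply.
by move=> p; rewrite inE => /eqP ->.
Qed.

Lemma graph0 : graph 0 0.
Proof. by have := @Graph [::]; rewrite !big_nil; apply. Qed.

Lemma graphD x x' y y' : graph x y -> graph x' y' -> graph (x + x') (y + y').
Proof.
move=> [s As_] [t At]; rewrite -!big_cat; apply: Graph => p.
by rewrite mem_cat => /orP[/As_|/At].
Qed.

Lemma graph_sum (I : eqType) (r : seq I) (f : I -> AA) (g : I -> B) :
  (forall i, i \in r -> graph (f i) (g i)) ->
  graph (\sum_(i <- r) f i) (\sum_(i <- r) g i).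
Proof.
elim: r => [|i r IH] h; first by rewrite !big_nil; exact: graph0.
rewrite !big_cons; apply: graphD; first by apply: h; rewrite mem_head.
by apply: IH => j jr; apply: h; rewrite inE jr orbT.
Qed.

Lemma graphZ (a : R[i]) x y : graph x y -> graph (a *: x) (a *: y).
Proof.
move=> [s hs]; rewrite !scaler_sumr; apply: graph_sum => p /hs Ap.
by have [_ pZ _ _] := hpsi p.1; rewrite -pZ //; apply/graph_comp/AZ.
Qed.

Lemma graph_star x y : graph x y -> graph (star x) (star y).
Proof.
move=> [s hs]; rewrite !raddf_sum; apply: graph_sum => p /hs Ap /=.
by have [_ _ _ ps] := hpsi p.1; rewrite -ps //; apply/graph_comp/As.
Qed.

Lemma graphM x x' y y' : graph x y -> graph x' y' -> graph (x *c x') (y *c y').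
Proof.
move=> [s hs] [t ht]; rewrite !cmul_suml; apply: graph_sum => p /hs Ap.
rewrite !cmul_sumr; apply: graph_sum => q /ht Aq.
by rewrite -hmul //; apply/graph_comp/AM.
Qed.

Lemma sum_fiber (V : nmodType) (F : seq L) s (f : L * AA -> V) : uniq F ->
  {subset [seq p.1 | p <- s] <= F} ->
  \sum_(i <- F) \sum_(p <- s | p.1 == i) f p = \sum_(p <- s) f p.
Proof.
move=> uF sF; under eq_bigr do rewrite big_mkcond.
rewrite exchange_big; apply: eq_big_seq => p ps.
rewrite -big_mkcond (eq_bigl (pred1 p.1)); last by move=> i; rewrite /= eq_sym.
by rewrite -big_filter filter_pred1_uniq ?big_seq1 // sF // map_f.
Qed.

(** Grouping a list by degree, over a finite meet-stable set of degrees. *)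
Lemma graph_family x y : graph x y ->
  exists (F : seq L) (S : L -> AA), [/\ uniq F, meet_stable F, component_family A S,
    x = \sum_(i <- F) S i & y = \sum_(i <- F) psi_ i (S i)].
Proof.
case=> s hs; set F := undup (meet_closure [seq p.1 | p <- s]).
have uF : uniq F by rewrite undup_uniq.
have sF : {subset [seq p.1 | p <- s] <= F}.
  by move=> i i_s; rewrite mem_undup sub_meet_closure.
have Asum i : A i (\sum_(p <- s | p.1 == i) p.2).
  rewrite big_seq_cond; apply: big_ind => //; first exact: AD.
  by move=> p /andP[/hs Ap /eqP <-].
exists F, (fun i => \sum_(p <- s | p.1 == i) p.2); split=> //.
- by move=> i j; rewrite !mem_undup; exact: meet_closureP.
- by rewrite sum_fiber.
rewrite -(sum_fiber _ uF sF); apply: eq_bigr => i _.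
have [pD _ _ _] := hpsi i.
elim: s hs {F uF sF Asum} => [|p s IH] hs; first by rewrite !big_nil.
have {}IH := IH (fun q qs => hs q (mem_behead (s := p :: s) qs)).
rewrite !big_cons; case: eqP => [pi|//]; rewrite IH pi pD //.
  by rewrite -pi; apply: hs; rewrite mem_head.
rewrite big_seq_cond; apply: big_ind => //; first exact: AD.
by move=> q /andP[qs /eqP <-]; apply: hs; rewrite inE qs orbT.
Qed.

(** By linearity it is enough to treat x = 0, where linear independence makes every
    component vanish. *)
Lemma graph_fun x y y' : graph x y -> graph x y' -> y = y'.
Proof.
move=> xy xy'; apply/eqP; rewrite -subr_eq0; apply/eqP.
have : graph 0 (y - y').
  by rewrite -(subrr x) -scaleN1r -[- y']scaleN1r; apply/graphD/graphZ.
move=> /graph_family[F [S [uF _ AS S0 ->]]].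
rewrite big_seq big1 // => i iF.
by rewrite (graded_sum0_eq0 hA uF AS (esym S0) iF).
Qed.

Lemma graph_graded_sum F x : graded_sum A F x -> exists y, graph x y.
Proof.
move=> [S AS ->]; exists (\sum_(i <- F) psi_ i (S i)).
by apply: graph_sum => i _; apply: graph_comp.
Qed.

Lemma star_hom_graph (f : AA -> B) : star_hom f ->
  (forall i x, A i x -> f x = psi_ i x) -> forall x y, graph x y -> f x = y.
Proof.
move=> [fD fZ _ _] fpsi x y [s]; elim: s => [|p s IH] hs.
  by rewrite !big_nil -(scale0r (0 : AA)) fZ // scale0r.
rewrite !big_cons fD // IH => [|q qs]; last by apply: hs; rewrite inE qs orbT.
by rewrite (fpsi p.1) //; apply: hs; rewrite mem_head.
Qed.

Definition graph_dom : set AA := [set x | exists y, graph x y].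

Definition graph_map x : B := xget 0 (graph x).

Lemma graph_mapP x : graph_dom x -> graph x (graph_map x).
Proof. by move=> [y xy]; apply: xgetPex; exists y. Qed.

Lemma graph_mapE x y : graph x y -> graph_map x = y.
Proof. by move=> xy; apply: graph_fun (xy); apply: graph_mapP; exists y. Qed.

Lemma graph_map_star_hom : star_hom_on graph_dom graph_map.
Proof.
split=> [x x' /graph_mapP gx /graph_mapP gx'|a x /graph_mapP gx|
  x x' /graph_mapP gx /graph_mapP gx'|x /graph_mapP gx]; apply: graph_mapE.
- exact: graphD.
- exact: graphZ.
- exact: graphM.
- exact: graph_star.
Qed.

(** x lies in the sum of finitely many components with meet-stable degrees.  That
    sum is a closed star-subalgebra, so automatic continuity applies, with a
    constant independent of it. *)
Lemma graph_map_nrm_le x : graph_dom x -> nrm (graph_map x) <= 2 * nrm x.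
Proof.
move=> [y /graph_family[F [S [uF mF AS xE _]]]].
have [C C0 hC] := component_nrm_le hA uF mF.
have subF := graded_sum_sub_cstar hA uF mF C0 hC.
apply: (star_hom_on_nrm_le subF); last by exists S.
have [mD mZ mM ms] := graph_map_star_hom.
have sub z : graded_sum A F z -> graph_dom z by exact: graph_graded_sum.
split=> [z t /sub Dz /sub Dt|a z /sub Dz|z t /sub Dz /sub Dt|z /sub Dz].
- exact: mD.
- exact: mZ.
- exact: mM.
- exact: ms.
Qed.

Lemma dense_graph_dom : dense graph_dom.
Proof.
have [_ _ tA _] := hA; move=> O O0 oO; have [x [Ox [n [c [v [Av xE]]]]]] := tA O O0 oO.
exists x; split=> //; rewrite {}xE.
apply: (big_ind graph_dom) => [|y z [y' yy'] [z' zz']|k _].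
- by exists 0; exact: graph0.
- by exists (y' + z'); exact: graphD.
- have [i _ Ai] := Av k; exists (c k *: psi_ i (v k)).
  exact/graphZ/graph_comp.
Qed.

End GradedHom.

Theorem proposition2p3p3 (R : realType) (d : Order.disp_t)
    (L : meetSemilatticeType d)
    (AA : cstarAlgType R) (A : L -> set AA) (hA : graded A)
    (B : cstarAlgType R) (psi_ : L -> AA -> B)
    (hpsi : forall i : L, star_hom_on (A i) (psi_ i))
    (hmul : forall (j k : L) (x y : AA), A j x -> A k y ->
       psi_ (j `&` k)%O (cmul x y) = cmul (psi_ j x) (psi_ k y)) :
  exists! psi : AA -> B,
    star_hom psi /\ forall (i : L) (x : AA), A i x -> psi x = psi_ i x.
Proof.
have dD : dense (graph_dom A psi_) by apply: dense_graph_dom.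
have mE i x : A i x -> graph_map A psi_ x = psi_ i x.
  by move=> Ax; apply: (graph_mapE hA hpsi); exact: graph_comp.
have [| | | | |g hom_g gE] := star_hom_extension _ _ _ _ dD
    (graph_map_star_hom hA hpsi hmul) (ler0n R 2).
- by move=> x y [x' xx'] [y' yy']; exists (x' + y'); exact: graphD.
- by move=> a x [x' xx']; exists (a *: x'); exact: graphZ.
- by move=> x y [x' xx'] [y' yy']; exists (x' *c y'); exact: graphM.
- by move=> x [x' xx']; exists (star x'); exact: graph_star.
- exact: graph_map_nrm_le.
have g_psi i x : A i x -> g x = psi_ i x.
  by move=> Ax; rewrite gE ?(mE i) //; exists (psi_ i x); exact: graph_comp.
exists g; split=> // h [hom_h h_psi].
apply: (star_hom_eq_dense dD) => // x [y xy].
by rewrite (star_hom_graph hom_g g_psi xy) (star_hom_graph hom_h h_psi xy).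
Qed.
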